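(* Let $l\ge1$ and $n\ge 1$ be integers, let $\lambda=(\lambda_1\ge\dots\ge\lambda_l\ge0)$ be a partition with at most $l$ non-zero parts, and $\mathbf t=(t_1,\dots,t_n)$. The $n$-point $d_\infty$-correlation functions of level $l+\frac12$ are given by $$\mathfrak D^{l+\frac12}_\lambda(q,\mathbf t)=\frac{\mathbb D^{l+\frac12}_\lambda(q,\mathbf t)+\overline{\mathbb D}^{\,l+\frac12}_\lambda(q,\mathbf t)}{2},\qquad \mathfrak D^{l+\frac12}_{\lambda\otimes\det}(q,\mathbf t)=\frac{\mathbb D^{l+\frac12}_\lambda(q,\mathbf t)-\overline{\mathbb D}^{\,l+\frac12}_\lambda(q,\mathbf t)}{2}.$$
   Context: **The Lie algebra $d_\infty$.** Let $\mathfrak{gl}$ be the Lie algebra of complex matrices $(a_{ij})_{i,j\in\mathbb Z}$ with $a_{ij}=0$ for $|i-j|$ large, and $E_{ij}$ the matrix units. Let $\overline d_\infty=\{(a_{ij})\in\mathfrak{gl}: a_{ij}=-a_{1-j,1-i}\}$ and let $d_\infty=\overline d_\infty\oplus\mathbb C C$ be its central extension by the 2-cocycle $C(A,B)=\mathrm{tr}([J,A]B)$, $J=\sum_{i\le 0}E_{ii}$. The triangular decomposition is induced from the grading in which $E_{ij}$ has weight $j-i$ (positive weight = raising). Put $H^d_i=E_{ii}+E_{-i,-i}-E_{i+1,i+1}-E_{-i+1,-i+1}$ for $i\ge1$ and $H^d_0=E_{0,0}+E_{-1,-1}-E_{2,2}-E_{1,1}+2C$; the fundamental weights $\Lambda^d_i$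 satisfy $\Lambda^d_i(H^d_j)=\delta_{ij}$. $L(d_\infty;\Lambda)$ is the irreducible highest weight module of highest weight $\Lambda$; its level is the scalar by which $C$ acts. For a partition $\lambda=(m_1,\dots,m_l)$ with $m_1\ge\dots\ge m_i>m_{i+1}=\dots=m_j=1>m_{j+1}=\dots=m_l=0$ put $$\Lambda(\lambda)=(2l+1-i-j)\Lambda_0^d+(j-i)\Lambda_1^d+\sum_{k=1}^i\Lambda^d_{m_k},\qquad \Lambda(\lambda\otimes\det)=(j-i)\Lambda_0^d+(2l+1-i-j)\Lambda_1^d+\sum_{k=1}^i\Lambda^d_{m_k},$$ both of level $l+\frac12$. Here $\det$ is the non-trivial one-dimensional representation of $O(2l+1)$, and $\lambda,\lambda\otimes\det$ label irreducible $O(2l+1)$-modules. **Fock space.** $\mathcal F^{l+\frac12}$ is the Fock space generated by a vacuum $|0\rangle$ by fermions $\psi^{\pm,p}_r$ ($1\le p\le l$) and $\varphi_r$, $r\in\frac12+\mathbb Z$, with $[\psi^{+,p}_r,\psi^{-,p'}_s]_+=\delta_{pp'}\delta_{r+s,0}$, $[\varphi_r,\varphi_s]_+=\delta_{r+s,0}$, all other anticommutators zero, and $\psi^{\pm,p}_r|0\rangle=\varphi_r|0\rangle=0$ for $r>0$. Normal ordering $:\ :$ moves operators annihilating $|0\rangle$ to the right with a sign. $d_\infty$ acts with $C=l+\frac12$ and $$E_{ij}-E_{1-j,1-i}\mapsto\sum_{p=1}^l\big(:\psi^{+,p}_{\frac12-i}\psi^{-,p}_{j-\frac12}:+:\psi^{-,p}_{\frac12-i}\psi^{+,p}_{j-\frac12}:\big)+:\varphi_{\frac12-i}\varphi_{j-\frac12}:.$$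 The energy operator is $L_0=\sum_p\sum_{k\in\frac12+\mathbb Z}k:\psi^{+,p}_{-k}\psi^{-,p}_k:+\sum_{k>0}k\varphi_{-k}\varphi_k$. The commuting $\mathfrak{so}(2l+1)$ is generated by $e_{pq}=\sum_r:\psi^{+,p}_r\psi^{-,q}_{-r}:$, $e^{\pm}_{pq}=\sum_r:\psi^{\pm,p}_r\psi^{\pm,q}_{-r}:$ ($p\ne q$), $e^\pm_p=\sum_r:\psi^{\pm,p}_r\varphi_{-r}:$. As an $(O(2l+1),d_\infty)$-module, $\mathcal F^{l+\frac12}\cong\bigoplus_\mu V_\mu(O(2l+1))\otimes L(d_\infty;\Lambda(\mu))$, where $\mu$ runs over all $\lambda$ and $\lambda\otimes\det$. The module $L(d_\infty;\Lambda(\lambda))\oplus L(d_\infty;\Lambda(\lambda\otimes\det))$ is realized in $\mathcal F^{l+\frac12}$ as the space of $\mathfrak{so}(2l+1)$-highest weight vectors of weight $\lambda$, i.e. vectors $v$ with $e_{pp}v=\lambda_pv$, $e_{pq}v=0$ ($p<q$), $e^+_{pq}v=0$, $e^+_pv=0$. **Operators and functions.** Put $$\mathsf D(t)=\sum_{k\ge1}(t^{k-\frac12}-t^{\frac12-k})(E_{k,k}-E_{1-k,1-k})+\frac{2}{t^{1/2}-t^{-1/2}}C,\qquad \alpha=\sum_{k>0}\varphi_{-k}\varphi_k .$$ For $\mu=\lambda$ or $\mu=\lambda\otimes\det$, the $n$-point $d_\infty$-correlation function of level $l+\frac12$ is $$\mathfrak D^{l+\frac12}_\mu(q,\mathbf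 t)=\mathrm{tr}_{L(d_\infty;\Lambda(\mu))}\,q^{L_0}\mathsf D(t_1)\cdots\mathsf D(t_n).$$ Further, with $M_\lambda=L(d_\infty;\Lambda(\lambda))\oplus L(d_\infty;\Lambda(\lambda\otimes\det))$, $$\mathbb D^{l+\frac12}_\lambda(q,\mathbf t)=\mathrm{tr}_{M_\lambda}\,q^{L_0}\mathsf D(t_1)\cdots\mathsf D(t_n),\qquad \overline{\mathbb D}^{\,l+\frac12}_\lambda(q,\mathbf t)=\mathrm{tr}_{M_\lambda}(-1)^\alpha q^{L_0}\mathsf D(t_1)\cdots\mathsf D(t_n).$$ Traces are formal series in $q^{1/2}$ with coefficients rational in the $t_i^{1/2}$. *)

(* Defs.v *)
From HB Require Import structures.
From mathcomp Require Import all_boot all_order all_algebra.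
From mathcomp Require Import all_classical reals.
From mathcomp Require Import complex.

Set Implicit Arguments.
Unset Strict Implicit.
Unset Printing Implicit Defensive.

Import Order.TTheory GRing.Theory Num.Theory.

Local Open Scope classical_set_scope.
Local Open Scope ring_scope.

(* Every infinite sum below is a finitely supported sum [\sum_(i \in A) _]:    *)
(* it is only used where all but finitely many terms vanish (on each fixed     *)
(* vector, for operators).                                                     *)

Section DInfinity.
Variable R : realType.
Local Notation C := (R[i]).

Definition zmx : Type := int -> int -> C.

Definition is_band (A : zmx) : Prop :=
  exists N : nat, forall i j : int, N%:Z < `|i - j| -> A i j = 0.

Definition in_dbar (A : zmx) : Prop :=
  is_band A /\ forall i j : int, A i j = - A (1 - j) (1 - i).

Definition unit_zmx (i j : int) : zmx := fun a b => ((a == i) && (b == j))%:R.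

Definition add_zmx (A B : zmx) : zmx := fun i j => A i j + B i j.
Definition sub_zmx (A B : zmx) : zmx := fun i j => A i j - B i j.
Definition scale_zmx (c : C) (A : zmx) : zmx := fun i j => c * A i j.
Definition mul_zmx (A B : zmx) : zmx :=
  fun i j => \sum_(k \in [set: int]) A i k * B k j.
Definition comm_zmx (A B : zmx) : zmx := sub_zmx (mul_zmx A B) (mul_zmx B A).
Definition tr_zmx (A : zmx) : C := \sum_(i \in [set: int]) A i i.

Definition J_zmx : zmx := fun i j => ((i == j) && (i <= 0))%:R.
Definition cocycle (A B : zmx) : C := tr_zmx (mul_zmx (comm_zmx J_zmx A) B).

(* The pair (A, c) stands for A + c C. *)
Definition dpair : Type := (zmx * C)%type.
Definition dinf (x : dpair) : Prop := in_dbar x.1.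

Definition dlincomb (c : C) (x y : dpair) : dpair :=
  (add_zmx (scale_zmx c x.1) y.1, c * x.2 + y.2).
Definition dbracket (x y : dpair) : dpair :=
  (comm_zmx x.1 y.1, cocycle x.1 y.1).

Definition d_raising (x : dpair) : Prop :=
  [/\ dinf x, (forall i j : int, j <= i -> x.1 i j = 0) & x.2 = 0].
Definition d_cartan (x : dpair) : Prop :=
  dinf x /\ forall i j : int, i != j -> x.1 i j = 0.

Definition Cd : dpair := ((fun _ _ => 0), 1).

Definition Hd (k : nat) : dpair :=
  let E i := unit_zmx i i in
  if k is 0%N
  then (sub_zmx (sub_zmx (add_zmx (E 0) (E (-1))) (E 2)) (E 1), 2)
  else (sub_zmx (sub_zmx (add_zmx (E k%:Z) (E (- k%:Z))) (E (k%:Z + 1)))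
                (E (- k%:Z + 1)), 0).

(* The argument s of Dd is t^(1/2). *)
Definition Dd (s : C) : dpair :=
  ((fun i j => \sum_(k \in [set k : int | 1 <= k])
       (s ^ (2 * k - 1) - s ^ (1 - 2 * k)) *
       sub_zmx (unit_zmx k k) (unit_zmx (1 - k) (1 - k)) i j),
   2 / (s - s^-1)).

(* Only the values of dact on d_oo are meaningful. *)
Record dinfModule := DinfModule {
  dcar :> lmodType C;
  dact : dpair -> {linear dcar -> dcar};
  dact_lincomb : forall (c : C) (x y : dpair) (v : dcar), dinf x -> dinf y ->
    dact (dlincomb c x y) v = c *: dact x v + dact y v;
  dact_bracket : forall (x y : dpair) (v : dcar), dinf x -> dinf y ->
    dact (dbracket x y) v = dact x (dact y v) - dact y (dact x v)
}.
Arguments dact {d}.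

Definition is_dsubmodule (L : dinfModule) (W : set L) : Prop :=
  [/\ W 0,
      (forall (c : C) (u v : L), W u -> W v -> W (c *: u + v)) &
      (forall (x : dpair) (v : L), dinf x -> W v -> W (dact x v))].

Definition is_dirreducible (L : dinfModule) : Prop :=
  (exists v : L, v != 0) /\
  forall W : set L, is_dsubmodule W -> W = [set 0] \/ W = setT.

(* A highest weight is recorded by its values Lam k on the Hd k and by its     *)
(* value c on C (the level).                                                   *)
Definition is_hw_vector (L : dinfModule) (Lam : nat -> nat) (c : C) (v : L) :
    Prop :=
  [/\ v != 0,
      (forall x, d_raising x -> dact x v = 0),
      (forall x, d_cartan x -> exists a : C, dact x v = a *: v),
      (forall k : nat, dact (Hd k) v = (Lam k)%:R *: v) &
      dact Cd v = c *: v].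

Definition is_irr_hw_module (L : dinfModule) (Lam : nat -> nat) (c : C) : Prop :=
  is_dirreducible L /\ exists v : L, is_hw_vector Lam c v.

Definition D_prod (L : dinfModule) (s : seq C) (v : L) : L :=
  foldr (fun s1 w => dact (Dd s1) w) v s.

End DInfinity.
Arguments dact {R d}.

(* Coefficients in the basis of fundamental weights. *)
Definition fund_wt (i : nat) : nat -> nat := fun k => (k == i).

Definition parts_gt1 (lam : seq nat) : nat := count (fun m => 1 < m)%N lam.
Definition parts_gt0 (lam : seq nat) : nat := count (fun m => 0 < m)%N lam.

Definition Lam_part (l : nat) (lam : seq nat) : nat -> nat := fun k =>
  let i := parts_gt1 lam in let j := parts_gt0 lam in
  ((2 * l + 1 - i - j) * fund_wt 0 k + (j - i) * fund_wt 1 k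
   + \sum_(m <- lam | 1 < m) fund_wt m k)%N.

Definition Lam_part_det (l : nat) (lam : seq nat) : nat -> nat := fun k =>
  let i := parts_gt1 lam in let j := parts_gt0 lam in
  ((j - i) * fund_wt 0 k + (2 * l + 1 - i - j) * fund_wt 1 k
   + \sum_(m <- lam | 1 < m) fund_wt m k)%N.

Section Fock.
Variables (R : realType) (l : nat).
Local Notation C := (R[i]).

(* Half-integer modes are indexed by int: the index n stands for r = n + 1/2.  *)
(* Thus r > 0 is 0 <= n, and r + s = 0 is m + n + 1 = 0. In psi b p n, the     *)
(* sign of psi^{+-,p} is + for b = true and - for b = false.                   *)
Record fockSpace := FockSpace {
  fcar :> lmodType C;
  vac : fcar;
  psi : bool -> 'I_l -> int -> {linear fcar -> fcar};
  phi : int -> {linear fcar -> fcar};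
  psi_psi : forall b b' p p' (m n : int) (v : fcar),
    psi b p m (psi b' p' n v) + psi b' p' n (psi b p m v) =
    if [&& b != b', p == p' & m + n + 1 == 0] then v else 0;
  phi_phi : forall (m n : int) (v : fcar),
    phi m (phi n v) + phi n (phi m v) = if m + n + 1 == 0 then v else 0;
  psi_phi : forall b p (m n : int) (v : fcar),
    psi b p m (phi n v) + phi n (psi b p m v) = 0;
  vac_neq0 : vac != 0;
  psi_vac : forall b p (n : int), 0 <= n -> psi b p n vac = 0;
  phi_vac : forall n : int, 0 <= n -> phi n vac = 0;
  vac_cyclic : forall W : set fcar,
    W vac ->
    (forall (c : C) (u v : fcar), W u -> W v -> W (c *: u + v)) ->
    (forall b p (n : int) (v : fcar), W v -> W (psi b p n v)) ->
    (forall (n : int) (v : fcar), W v -> W (phi n v)) ->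
    W = setT
}.

Variable F : fockSpace.

(* The index of the mode -r. *)
Definition opm (n : int) : int := - n - 1.
Definition half_of (n : int) : C := n%:~R + 2^-1.

(* :a_r b_s: with r = m + 1/2 and s = n + 1/2. *)
Definition nord (a b : int -> {linear F -> F}) (m n : int) (v : F) : F :=
  if 0 <= m then - b n (a m v) else a m (b n v).

(* The image of E_{ij} - E_{1-j,1-i}. *)
Definition fock_E (i j : int) (v : F) : F :=
  (\sum_(p < l) (nord (psi F true p) (psi F false p) (- i) (j - 1) v
                 + nord (psi F false p) (psi F true p) (- i) (j - 1) v))
  + nord (phi F) (phi F) (- i) (j - 1) v.

(* The factor 1/2 occurs because A = 1/2 \sum_{i,j} a_ij (E_ij - E_{1-j,1-i})  *)
(* when a_ij = - a_{1-j,1-i}.                                                  *)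
Definition fock_act (x : dpair R) (v : F) : F :=
  2^-1 *: (\sum_(ij \in [set: int * int]) x.1 ij.1 ij.2 *: fock_E ij.1 ij.2 v)
  + (x.2 * (l%:R + 2^-1)) *: v.

Definition energy (v : F) : F :=
  (\sum_(p < l) \sum_(k \in [set: int])
      half_of k *: nord (psi F true p) (psi F false p) (opm k) k v)
  + \sum_(k \in [set k : int | 0 <= k]) half_of k *: phi F (opm k) (phi F k v).

Definition alpha (v : F) : F :=
  \sum_(k \in [set k : int | 0 <= k]) phi F (opm k) (phi F k v).

Definition so_e (p q : 'I_l) (v : F) : F :=
  \sum_(k \in [set: int]) nord (psi F true p) (psi F false q) k (opm k) v.
Definition so_eplus2 (p q : 'I_l) (v : F) : F :=
  \sum_(k \in [set: int]) nord (psi F true p) (psi F true q) k (opm k) v.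
Definition so_eplus1 (p : 'I_l) (v : F) : F :=
  \sum_(k \in [set: int]) nord (psi F true p) (phi F) k (opm k) v.

Definition M_space (lam : l.-tuple nat) : set F :=
  [set v | [/\ (forall p, so_e p p v = (tnth lam p)%:R *: v),
               (forall p q : 'I_l, (p < q)%N -> so_e p q v = 0),
               (forall p q : 'I_l, p != q -> so_eplus2 p q v = 0) &
               (forall p, so_eplus1 p v = 0)]].

Definition fock_D_prod (s : seq C) (v : F) : F :=
  foldr (fun s1 w => fock_act (Dd s1) w) v s.

End Fock.
Arguments M_space {R l} F lam.

Section Traces.
Variable R : realType.
Local Notation C := (R[i]).

Definition is_basis (V : lmodType C) (U : set V) (d : nat) (e : 'I_d -> V) :
    Prop :=
  (forall i, U (e i)) /\
  forall v, U v -> exists! x : 'rV[C]_d, v = \sum_i x 0 i *: e i.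

Definition is_trace (V : lmodType C) (U : set V) (T : V -> V) (c : C) : Prop :=
  exists (d : nat) (e : 'I_d -> V) (A : 'M[C]_d),
    [/\ is_basis U e, (forall i, T (e i) = \sum_j A i j *: e j) & c = \tr A].

(* The trace of T on a finite-dimensional T-stable subspace U. *)
Definition trace_on (V : lmodType C) (U : set V) (T : V -> V) : C :=
  xget 0 [set c | is_trace U T c].

(* (-1)^T for a diagonalizable operator T with eigenvalues in nat. *)
Definition sign_pow (V : lmodType C) (T : V -> V) (v : V) : V :=
  xget 0 [set w | exists (N : nat) (u : 'I_N -> V),
    [/\ (forall a : 'I_N, T (u a) = a%:R *: u a), v = \sum_a u a &
        w = \sum_(a < N) (-1) ^+ a *: u a]].

End Traces.

Section Correlation.
Variables (R : realType) (l : nat) (F : fockSpace R l).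
Local Notation C := (R[i]).

Definition is_equivariant (L : dinfModule R) (f : {linear L -> F}) : Prop :=
  forall (x : dpair R) (v : L), dinf x -> f (dact x v) = fock_act x (f v).

(* L1 (+) L2 is realized in F, as a d_oo-module, as the space M_lambda, via    *)
(* (u, v) |-> f1 u + f2 v.                                                     *)
Definition realizes_M (lam : l.-tuple nat) (L1 L2 : dinfModule R)
    (f1 : {linear L1 -> F}) (f2 : {linear L2 -> F}) : Prop :=
  [/\ is_equivariant f1, is_equivariant f2,
      (forall u v, f1 u + f2 v = 0 -> u = 0 /\ v = 0) &
      M_space F lam = [set w | exists u v, w = f1 u + f2 v]].

(* Formal series in q^(1/2) are given by their coefficients: the coefficient   *)
(* of q^(m/2) in tr q^{L_0} X is the trace of X on the m/2-eigenspace of L_0.  *)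
(* The spectrum of L_0 on F is contained in (1/2) nat.                         *)
Definition qseries : Type := nat -> C.

(* On a d_oo-module L realized in F through f, L_0 is the restriction of the   *)
(* energy operator of F.                                                       *)
Definition frakD (L : dinfModule R) (f : {linear L -> F}) (s : seq C) :
    qseries := fun m =>
  trace_on [set v : L | energy (f v) = (m%:R / 2) *: f v] (D_prod s).

Definition bbD (lam : l.-tuple nat) (s : seq C) : qseries := fun m =>
  trace_on (M_space F lam `&` [set v | energy v = (m%:R / 2) *: v])
    (fock_D_prod s).

Definition bbD_bar (lam : l.-tuple nat) (s : seq C) : qseries := fun m =>
  trace_on (M_space F lam `&` [set v | energy v = (m%:R / 2) *: v])
    (fun v => sign_pow (alpha (F := F)) (fock_D_prod s v)).

End Correlation.

(* Main.v *)
(* The words in the creation operators applied to the vacuum span the Fock     *)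
(* space, and alpha, L_0, the so(2l+1)-charges and the diagonal elements of    *)
(* d_oo all act on each word by a scalar. On an so(2l+1)-highest weight vector *)
(* of weight lambda which is also a d_oo-highest weight vector, the total      *)
(* number of fermions is [\sum_k k Lam(H_k)] and the number of psi^+ minus the *)
(* number of psi^- is |lambda|; hence the number of phi is congruent mod 2 to  *)
(* the sum of these two integers, which is even for Lam(lambda) and odd for    *)
(* Lam(lambda (x) det). As d_oo acts by quadratic expressions, it preserves    *)
(* the parity of the number of phi, so by irreducibility (-1)^alpha is 1 on    *)
(* L(Lam(lambda)) and -1 on L(Lam(lambda (x) det)).                            *)
Require Import Defs.
From HB Require Import structures.
From mathcomp Require Import all_boot all_order all_algebra.
From mathcomp Require Import all_classical reals.
From mathcomp Require Import complex.
From mathcomp Require Import ring zify.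

Set Implicit Arguments.
Unset Strict Implicit.
Unset Printing Implicit Defensive.

Import Order.TTheory GRing.Theory Num.Theory.

Local Open Scope ring_scope.

(** The operator $(-1)^\alpha$ is $+1$ on the summand of $M_\lambda$ of weight $\Lambda(\lambda)$
    and $-1$ on the summand of weight $\Lambda(\lambda\otimes\det)$. Hence [bbD] is the sum and
    [bbD_bar] the difference of the two correlation functions, and solving for these gives the
    claim.

    The signs come from counting fermions. Words in the creation operators span the Fock space
    ([wspan_full]). The operators [alpha], [energy], [so_e p p] and the Cartan part of $d_\infty$
    are combinations of occupation numbers, so they scale each word ([number_word],
    [diagonal_number]). Words are not linearly independent, yet an eigenvector is a combination of
    words having its eigenvalue ([diagonal_eigen]). On the highest weight vector, $\sum_k k H_k$
    counts all fermions and $\sum_p e_{pp}$ the excess of $\psi^+$ over $\psi^-$, which fixes the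
    parity of the number of $\varphi$ ([hw_parity], evaluated by [Lam_part_sum] and
    [Lam_part_det_sum]). Irreducibility spreads this parity over the summand ([realized_parity]).

    Traces and $(-1)^\alpha$ are defined by choosing a basis or an eigenvector decomposition.
    [trace_on_eq] and [sign_pow_eq] make the choice immaterial, and [energy_eigenspace_finite]
    ensures that bases exist. *)

Section LinearAlgebra.
Variable R : realType.
Local Notation C := (R[i]).
Implicit Types V W : lmodType C.

(** * Separation of eigenvalues and the operator $(-1)^T$ *)

Lemma linear_packed V W (T : V -> W) :
  linear T -> exists T' : {linear V -> W}, T =1 T'.
Proof.
move=> linT; pose T' : {linear V -> W} := HB.pack T (GRing.isLinear.Build _ _ _ _ T linT).
by exists T'.
Qed.

Definition charpoly_op V (T : V -> V) (B : seq C) (v : V) : V :=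
  foldr (fun b u => T u - b *: u) v B.

Lemma charpoly_op_linear V (T : {linear V -> V}) B : linear (charpoly_op T B).
Proof.
move=> c u v; elim: B => //= b B ->.
by rewrite linearP scalerDr scalerBr !scalerA opprD addrACA [b * c]mulrC.
Qed.

Lemma charpoly_op_eigen V (T : {linear V -> V}) B a v :
  T v = a *: v -> charpoly_op T B v = (\prod_(b <- B) (a - b)) *: v.
Proof.
move=> Tv; elim: B => [|b B /= ->]; first by rewrite big_nil scale1r.
by rewrite big_cons linearZ_LR /= Tv !scalerA -scalerBl mulrBl [_ * a]mulrC.
Qed.

(* Applying [\prod_b (T - b)], with [b] running over the other eigenvalues,   *)
(* to both sides of the decomposition isolates the [a]-component.             *)
Lemma eigen_component V (T : V -> V) (J : eqType) (r : seq J) (e : J -> V)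
    (ev : J -> C) (a : C) :
  linear T -> (forall i, T (e i) = ev i *: e i) ->
  T (\sum_(i <- r) e i) = a *: \sum_(i <- r) e i ->
  \sum_(i <- r) e i = \sum_(i <- r | ev i == a) e i.
Proof.
move=> /linear_packed[T' TT'] Te Tv.
have T'e i : T' (e i) = ev i *: e i by rewrite -TT' Te.
set v := (X in X = _); have T'v : T' v = a *: v by rewrite -TT'.
pose B := [seq ev i | i <- r & ev i != a].
have nz : \prod_(b <- B) (a - b) != 0.
  rewrite big_map big_filter prodf_seq_neq0; apply/allP => i _.
  by apply/implyP; rewrite subr_eq0 eq_sym.
apply: (scalerI nz); rewrite -(charpoly_op_eigen _ T'v).
have [P PE] := linear_packed (charpoly_op_linear T' B).
rewrite PE /v linear_sum /= (bigID (fun i => ev i == a)) /= [X in _ + X]big1_seq.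
  rewrite addr0 scaler_sumr; apply: eq_bigr => i /eqP <-.
  by rewrite -PE; apply: charpoly_op_eigen.
move=> i /andP[ia ir]; rewrite -PE (charpoly_op_eigen _ (T'e i)).
suff -> : \prod_(b <- B) (ev i - b) = 0 by rewrite scale0r.
apply/eqP; rewrite big_map big_filter prodf_seq_eq0; apply/hasP.
by exists i; rewrite // ia subrr eqxx.
Qed.

(** Eigenvectors for distinct eigenvalues are independent, so the decomposition picked by [sign_pow]
    agrees, up to zero terms, with any given one. *)
Lemma sign_pow_eq V (T : V -> V) N (u : 'I_N -> V) : linear T ->
  (forall a : 'I_N, T (u a) = a%:R *: u a) ->
  sign_pow T (\sum_(a < N) u a) = \sum_(a < N) (-1) ^+ a *: u a.
Proof.
move=> linT Tu; rewrite /sign_pow.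
case: xgetP => [w _ [N' [u' [Tu' vu' ->]]]|]; last first.
  move=> /(_ (\sum_(a < N) (-1) ^+ a *: u a)) /=; case; first by exists N, u.
(* Both families are padded by zeros to a common length, so that they can be subtracted term by
   term. *)
pose ext N (u : 'I_N -> V) k := if insub k is Some i then u i else 0.
have extE M (w' : 'I_M -> V) (i : 'I_M) : ext M w' i = w' i.
  by rewrite /ext insubT // => h; congr w'; apply: val_inj.
have ext0 M (w' : 'I_M -> V) k : (M <= k)%N -> ext M w' k = 0.
  by move=> h; rewrite /ext insubF // ltnNge h.
have Text M (w' : 'I_M -> V) k : (forall a : 'I_M, T (w' a) = a%:R *: w' a) ->
    T (ext M w' k) = k%:R *: ext M w' k.
  move=> Tw; have [h|h] := leqP M k; last first.
    by rewrite -[k]/(val (Ordinal h)) extE Tw.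
  have [T' TT'] := linear_packed linT.
  by rewrite ext0 // TT' linear0 scaler0.
have sumE M (w' : 'I_M -> V) K (g : nat -> C) : (M <= K)%N ->
    \sum_(a < M) g a *: w' a = \sum_(a < K) g a *: ext M w' a.
  move=> MK; under eq_bigr do rewrite -extE.
  rewrite (big_ord_widen K (fun i => g i *: ext M w' i)) // big_mkcond /=.
  apply: eq_bigr => i _; case: ltnP => // h.
  by rewrite ext0 // scaler0.
pose K := maxn N N'.
rewrite (sumE _ u' K (fun a => (-1) ^+ a)) ?leq_maxr //.
rewrite (sumE _ u K (fun a => (-1) ^+ a)) ?leq_maxl //.
apply: eq_bigr => k _; congr (_ *: _); apply/eqP; rewrite -subr_eq0; apply/eqP.
pose d (i : 'I_K) := ext N' u' i - ext N u i.
have d0 : \sum_i d i = 0.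
  rewrite sumrB.
  have sum1 M (w' : 'I_M -> V) : (M <= K)%N ->
      \sum_(a < K) ext M w' a = \sum_a w' a.
    move=> MK; under eq_bigr do rewrite -[ext _ _ _]scale1r.
    by rewrite -(sumE M w' K (fun=> 1)) //; under eq_bigr do rewrite scale1r.
  by rewrite !sum1 ?leq_maxl ?leq_maxr // vu' subrr.
have [T' TT'] := linear_packed linT.
have Td (i : 'I_K) : T (d i) = i%:R *: d i.
  by rewrite /d TT' linearB -!TT' !Text // scalerBr.
(* The sum of the differences is 0, an eigenvector for every scalar; its component at [k] is [d k],
   which therefore vanishes. *)
have := @eigen_component V T _ (index_enum 'I_K) d (fun i => i%:R) k%:R linT Td.
rewrite d0 TT' linear0 scaler0 => /(_ erefl).
rewrite (big_pred1 k) => [|i]; first by rewrite -/(d k) => <-.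
by rewrite eqr_nat.
Qed.

(** * Finite spans, bases and traces *)

Fixpoint in_span V (g : seq V) (v : V) : Prop :=
  if g is x :: g' then exists c : C, in_span g' (v - c *: x) else v = 0.

Lemma in_span_lincomb V (g : seq V) (c : C) u v :
  in_span g u -> in_span g v -> in_span g (c *: u + v).
Proof.
elim: g u v => [u v /= -> ->|x g IH u v /= [a ua] [b vb]].
  by rewrite scaler0 addr0.
exists (c * a + b); rewrite scalerDl opprD addrACA -scalerA -scalerBr.
exact: IH.
Qed.

Lemma in_span0 V (g : seq V) : in_span g 0.
Proof.
by elim: g => //= x g IH; exists 0; rewrite scale0r subr0.
Qed.

Lemma in_span_mem V (g : seq V) v : v \in g -> in_span g v.
Proof.
elim: g => //= x g IH; rewrite inE => /orP[/eqP->|/IH vg].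
  by exists 1; rewrite scale1r subrr; apply: in_span0.
by exists 0; rewrite scale0r subr0.
Qed.

Definition subspace V (U : set V) : Prop :=
  U 0 /\ forall (c : C) u v, U u -> U v -> U (c *: u + v).

Lemma subspaceN V (U : set V) u v : subspace U -> U u -> U v -> U (v - u).
Proof. by case=> _ h Uu Uv; rewrite addrC -scaleN1r; apply: h. Qed.

Lemma subspace_sum V (U : set V) (J : Type) (r : seq J) (P : pred J)
    (c : J -> C) (e : J -> V) :
  subspace U -> (forall i, P i -> U (e i)) -> U (\sum_(i <- r | P i) c i *: e i).
Proof.
move=> [U0 UP] Ue; elim/big_rec: _ => // i x Pi; apply: UP; exact: Ue.
Qed.

Lemma is_basisP V (U : set V) d (e : 'I_d -> V) :
  (forall i, U (e i)) ->
  (forall v, U v -> exists x : 'rV[C]_d, v = \sum_i x 0 i *: e i) ->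
  (forall x : 'rV[C]_d, \sum_i x 0 i *: e i = 0 -> x = 0) ->
  is_basis U e.
Proof.
move=> Ue gen free; split=> // v /gen[x vx]; exists x; split=> // y vy.
apply/eqP; rewrite -subr_eq0; apply/eqP/free.
under eq_bigr do rewrite !mxE scalerBl.
by rewrite sumrB -vx -vy subrr.
Qed.

Lemma basis_free V (U : set V) d (e : 'I_d -> V) (x : 'rV[C]_d) :
  subspace U -> is_basis U e -> \sum_i x 0 i *: e i = 0 -> x = 0.
Proof.
move=> [U0 _] [_ eP] x0; have [y [_ yP]] := eP _ U0.
rewrite -(yP x) ?x0 // (yP 0) //.
by rewrite big1 // => i _; rewrite mxE scale0r.
Qed.

(** Induction on the generators: the vectors of [U] in the span of the tail form a subspace [U']
    with a basis. Either [U'] is all of [U], or one vector [u] of [U] outside [U'] completes that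
    basis. *)
Lemma finite_span_basis V (g : seq V) (U : set V) :
  subspace U -> (forall v, U v -> in_span g v) ->
  exists d (e : 'I_d -> V), is_basis U e.
Proof.
elim: g U => [|x g IH] U [U0 UP] Ug.
  exists 0%N, (fun=> 0); apply: is_basisP => [i|v|z _]; first by case: i.
  - by move=> /Ug /= ->; exists 0; rewrite big_ord0.
  - by rewrite thinmx0.
pose U' : set V := [set v | U v /\ in_span g v]%classic.
have sU' : subspace U'.
  split; first by split=> //; apply: in_span0.
  by move=> c u v [Uu gu] [Uv gv]; split; [apply: UP|apply: in_span_lincomb].
have [|d [e eU']] := IH U' sU'; first by move=> v [].
have [UU'|/existsNP[u /not_implyP[Uu U'u]]] := pselect (forall v, U v -> U' v).
  exists d, e; split=> [i|v /UU']; last by case: eU' => _; apply.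
  by case: eU' => /(_ i)[].
have [a ga] := Ug _ Uu.
have a0 : a != 0.
  by apply: contra_notN U'u => /eqP a0; split=> //; move: ga; rewrite a0 scale0r subr0.
exists d.+1, (fun i => oapp e u (unlift ord0 i)).
have sumE (z : 'rV[C]_d.+1) :
    \sum_i z 0 i *: oapp e u (unlift ord0 i) =
    z 0 0 *: u + \sum_i (\row_j z 0 (lift ord0 j)) 0 i *: e i.
  rewrite big_ord_recl unlift_none /=; congr (_ + _).
  by apply: eq_bigr => i _; rewrite liftK mxE.
have [eU eg] := eU'.
apply: is_basisP => [i|v Uv|z].
- by case: unliftP => [j|] _ //=; case: (eU j).
- have [b gb] := Ug _ Uv.
  (* The factor [b / a] cancels the coefficient of the generator [x], which is [a] in [u] and [b] in
     [v]. *)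
  have : U' (v - (b / a) *: u).
    split; first by rewrite addrC -scaleNr; apply: UP.
    rewrite (_ : _ - _ = - (b / a) *: (u - a *: x) + (v - b *: x)).
      exact: in_span_lincomb.
    by rewrite scalerBr !scaleNr scalerA divfK // opprK addrACA subrr addr0 addrC.
  move=> /eg[y [vy _]].
  exists (\row_i oapp (y 0) (b / a) (unlift ord0 i)).
  rewrite sumE mxE unlift_none /=; apply/eqP; rewrite addrC -subr_eq vy.
  by apply/eqP/eq_bigr => i _; rewrite !mxE liftK.
- rewrite sumE => z0.
  have z00 : z 0 0 = 0.
    have [//|nz] := eqVneq (z 0 0) 0; exfalso; apply: U'u.
    have -> : u = - (z 0 0)^-1 *: (\sum_i (\row_j z 0 (lift ord0 j)) 0 i *: e i) + 0.
      rewrite addr0 -[X in _ *: X](addKr (z 0 0 *: u)) z0 addr0.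
      by rewrite scaleNr scalerN opprK scalerA mulVf // scale1r.
    case: (sU') => h0 h; apply: (h _ _ _ _ h0).
    exact: subspace_sum.
  move: z0; rewrite z00 scale0r add0r => /(basis_free sU' eU') z0.
  apply/rowP => i; rewrite mxE; case: (unliftP ord0 i) => [j|] ->; last exact: z00.
  by move/rowP: z0 => /(_ j); rewrite !mxE.
Qed.

(** The matrices of [T] in two bases are conjugate, so the basis picked by [trace_on] is immaterial.
    Linearity is asked only on [U], where it will be established for the signed operator. *)
Lemma trace_on_eq V (U : set V) (T : V -> V) d (e : 'I_d -> V) (A : 'M[C]_d) :
  subspace U -> (forall (c : C) u v, U u -> U v -> T (c *: u + v) = c *: T u + T v) ->
  is_basis U e -> (forall i, T (e i) = \sum_j A i j *: e j) ->
  trace_on U T = \tr A.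
Proof.
move=> sU linT eU TA; rewrite /trace_on; case: xgetP => [c _|]; last first.
  by move=> /(_ (\tr A)); case; exists d, e, A.
case=> d' [e' [A' [e'U TA' ->]]].
have [Ue eg] := eU; have [Ue' e'g] := e'U.
have coord d1 d2 (e1 : 'I_d1 -> V) (e2 : 'I_d2 -> V) :
    is_basis U e1 -> (forall i, U (e2 i)) ->
    exists P : 'M[C]_(d2, d1), forall i, e2 i = \sum_j P i j *: e1 j.
  move=> [_ h1] h2.
  have [y yP] := choice (fun i =>
    let: ex_intro y (conj h _) := h1 _ (h2 i) in ex_intro _ y h).
  exists (\matrix_(i, j) y i 0 j) => i; rewrite {1}yP.
  by apply: eq_bigr => j _; rewrite mxE.
have [P eP] := coord _ _ _ _ eU Ue'.
have [Q eQ] := coord _ _ _ _ e'U Ue.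
have mulE d1 d2 d3 (X : 'M[C]_(d1, d2)) (Y : 'M[C]_(d2, d3)) (g : 'I_d3 -> V) i :
    \sum_j X i j *: (\sum_k Y j k *: g k) = \sum_k (X *m Y) i k *: g k.
  under eq_bigr do rewrite scaler_sumr.
  rewrite exchange_big; apply: eq_bigr => k _ /=.
  rewrite mxE scaler_suml; by apply: eq_bigr => j _; rewrite scalerA.
have inj d1 d2 (X Y : 'M[C]_(d1, d2)) (g : 'I_d2 -> V) : is_basis U g ->
    (forall i, \sum_k X i k *: g k = \sum_k Y i k *: g k) -> X = Y.
  move=> gU XY; apply/row_matrixP => i; apply/eqP; rewrite -subr_eq0; apply/eqP.
  apply: (basis_free sU gU); under eq_bigr do rewrite !mxE scalerBl.
  by rewrite sumrB XY subrr.
have Tsum n (X : 'I_n -> C) (g : 'I_n -> V) : (forall i, U (g i)) ->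
    T (\sum_i X i *: g i) = \sum_i X i *: T (g i).
  have T0 : T 0 = 0.
    have [U0 _] := sU; have := linT 1 0 0 U0 U0.
    by rewrite !scale1r addr0 -{1}[T 0]addr0 => /addrI.
  (* Membership in [U] is carried through the induction because [T] is additive only there. *)
  move=> Ug; pose K x y := U x /\ T x = y.
  suff [] : K (\sum_i X i *: g i) (\sum_i X i *: T (g i)) by [].
  elim/big_rec2: _ => [|i x y _ [Uy Ty]]; first by split=> //; case: sU.
  by split; [case: sU => _; apply | rewrite linT // Ty].
have QP : Q *m P = 1%:M.
  apply: (inj _ _ _ _ e) => // i; rewrite -mulE.
  under eq_bigr do rewrite -eP.
  rewrite -eQ (bigD1 i) //= mxE eqxx scale1r big1 ?addr0 // => j ji.
  by rewrite mxE eq_sym (negbTE ji) scale0r.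
have AP : A' *m P = P *m A.
  apply: (inj _ _ _ _ e) => // i; rewrite -!mulE.
  under eq_bigr do rewrite -eP.
  rewrite -TA' eP Tsum //.
  by under [RHS]eq_bigr do rewrite -TA.
have e'Q : P *m Q = 1%:M.
  apply: (inj _ _ _ _ e') => // i; rewrite -mulE.
  under eq_bigr do rewrite -eQ.
  rewrite -eP (bigD1 i) //= mxE eqxx scale1r big1 ?addr0 // => j ji.
  by rewrite mxE eq_sym (negbTE ji) scale0r.
by rewrite -[A']mulmx1 -e'Q mulmxA AP mxtrace_mulC mulmxA QP mul1mx.
Qed.

End LinearAlgebra.

(** * Sums over the integers with finite support *)

Section FiniteSupport.
Variables (V : zmodType).

(** As mode indices, [Posz k] and [Negz k] stand for $k+\frac12$ and $-(k+\frac12)$, so opposite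
    modes are grouped together. *)
Lemma fsum_int (G : int -> V) (K : nat) :
  (forall k, (K <= k)%N -> G (Posz k) = 0) ->
  (forall k, (K <= k)%N -> G (Negz k) = 0) ->
  \sum_(k \in [set: int]) G k = \sum_(k < K) (G (Posz k) + G (Negz k)).
Proof.
move=> G0 G1; pose r := map Posz (iota 0 K) ++ map Negz (iota 0 K).
have rE n : (n \in r) = match n with Posz k | Negz k => (k < K)%N end.
  rewrite mem_cat; case: n => k.
  - rewrite mem_map; last by move=> ? ? [].
    by rewrite mem_iota /= add0n orbC; case: mapP => // -[].
  - rewrite mem_map; last by move=> ? ? [].
    by rewrite mem_iota /= add0n; case: mapP => // -[].
rewrite (fsbigE r) //.
- under eq_bigl do rewrite in_setT.
  rewrite big_cat !big_map big_split /=.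
  rewrite -(big_mkord xpredT (fun k => G (Posz k))).
  by rewrite -(big_mkord xpredT (fun k => G (Negz k))) /index_iota subn0.
- rewrite cat_uniq !map_inj_uniq ?iota_uniq /=; try by move=> ? ? [].
  by rewrite andbT; apply/hasPn => _ /mapP[k _ ->]; apply/mapP => -[].
- by move=> k _; rewrite rE; case: k => k; rewrite -leqNgt; [apply: G0|apply: G1].
Qed.

Lemma fsum_nonneg (G : int -> V) (K : nat) :
  (forall k, (K <= k)%N -> G (Posz k) = 0) ->
  \sum_(k \in [set k : int | (0 <= k)%R]) G k = \sum_(k < K) G (Posz k).
Proof.
move=> G0; rewrite fsbig_mkcond (@fsum_int _ K) => [|k /G0 Gk|k _]; rewrite /patch.
- apply: eq_bigr => k _; rewrite [X in _ + X]ifF ?addr0; last first.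
    by apply/negP; rewrite inE.
  by rewrite ifT // inE.
- by rewrite Gk; case: ifP.
- by rewrite ifF //; apply/negP; rewrite inE.
Qed.

Lemma fsum_diag (H : int * int -> V) :
  (forall i j, i != j -> H (i, j) = 0) ->
  \sum_(ij \in [set: int * int]) H ij = \sum_(i \in [set: int]) H (i, i).
Proof.
move=> H0; have injd : injective (fun i : int => (i, i)) by move=> i j [].
rewrite -(fsbig_image [set: int] (fun i : int => (i, i)) H); last first.
  by move=> i j _ _ /injd.
apply/esym/fsbig_widen => // -[i j] [_ /= nd].
by apply: H0; apply: contra_notN nd => /eqP ->; exists j.
Qed.

End FiniteSupport.

(** * Words in the creation operators and operators diagonal on them *)

Section Words.
Variables (R : realType) (l : nat) (F : fockSpace R l).
Local Notation C := (R[i]).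
Local Notation I := (option (bool * 'I_l)).

(* [Some (true, p)], [Some (false, p)] and [None] stand for psi^{+,p},        *)
(* psi^{-,p} and phi.                                                         *)
Definition gen (x : I) : int -> {linear F -> F} :=
  match x with Some a => psi F a.1 a.2 | None => phi F end.

Definition dual_gen (x : I) : I := omap (fun a => (~~ a.1, a.2)) x.

Lemma dual_genK : involutive dual_gen.
Proof. by case=> [[b p]|] //=; rewrite negbK. Qed.

Lemma gen_car x y (m n : int) v :
  gen x m (gen y n v) + gen y n (gen x m v) =
  if (y == dual_gen x) && (m + n + 1 == 0) then v else 0.
Proof.
case: x y => [[b p]|] [[b' p']|] /=.
- rewrite psi_psi -[Some _ == _]/((b' == ~~ b) && (p' == p)) andbA.
  by rewrite [p' == p]eq_sym; case: b b' => [] [].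
- exact: psi_phi.
- by rewrite addrC psi_phi.
- exact: phi_phi.
Qed.

Lemma gen_vac x (n : nat) : gen x n (vac F) = 0.
Proof. by case: x => [[b p]|] /=; [apply: psi_vac|apply: phi_vac]. Qed.

Definition letter : Type := (I * nat)%type.

(* The creation operator with mode [- (k + 1/2)]. *)
Definition create (a : letter) : {linear F -> F} := gen a.1 (Negz a.2).

Definition wvec (w : seq letter) : F := foldr create (vac F) w.

(** Words satisfy linear relations, since reordering letters changes signs and a repeated letter
    gives 0. So [Q] constrains some expression of [v], not every one. *)
Definition wspan (Q : pred (seq letter)) (v : F) : Prop :=
  exists s : seq (C * seq letter),
    all (Q \o snd) s /\ v = \sum_(a <- s) a.1 *: wvec a.2.

Lemma wspan_subspace Q : subspace (wspan Q).
Proof.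
split; first by exists [::]; rewrite big_nil.
move=> c u v [s [Qs ->]] [s' [Qs' ->]].
exists ([seq (c * a.1, a.2) | a <- s] ++ s'); split.
  by rewrite all_cat all_map Qs' andbT; apply: sub_all Qs => a.
rewrite big_cat big_map scaler_sumr; congr (_ + _).
by apply: eq_bigr => a _; rewrite scalerA.
Qed.

Lemma wspan_word (Q : pred (seq letter)) w : Q w -> wspan Q (wvec w).
Proof.
by move=> Qw; exists [:: (1, w)]; rewrite /= Qw big_seq1 scale1r.
Qed.

Lemma wspan_sub (Q Q' : pred (seq letter)) v :
  (forall w, Q w -> Q' w) -> wspan Q v -> wspan Q' v.
Proof.
by move=> QQ' [s [Qs ->]]; exists s; split=> //; apply: sub_all Qs => a; apply: QQ'.
Qed.

Lemma wspan_linear (Q Q' : pred (seq letter)) (T : F -> F) : linear T ->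
  (forall w, Q w -> wspan Q' (T (wvec w))) -> forall v, wspan Q v -> wspan Q' (T v).
Proof.
move=> /linear_packed[T' TT'] QT v [s [/allP Qs ->]].
rewrite TT' linear_sum /= big_seq.
have [_ sub] := wspan_subspace Q'.
elim/big_rec: _ => [|a x /Qs Qa Qx]; first by case: (wspan_subspace Q').
by rewrite linearZ_LR; apply: sub => //; rewrite -TT'; apply: QT.
Qed.

Definition parity (h : pred I) (w : seq letter) : bool := odd (count (h \o fst) w).

(** A creation operator adds a letter of species [x]. An annihilation operator moves right through
    the word until it kills the vacuum; each contraction on the way deletes a letter of the dual
    species, which has the same value under [h]. *)
Lemma wspan_parity_gen (h : pred I) e x n v : (forall y, h (dual_gen y) = h y) ->
  wspan (fun w => parity h w == e) v ->
  wspan (fun w => parity h w == e (+) h x) (gen x n v).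
Proof.
move=> hd; apply: wspan_linear => [|w /eqP <-]; first exact: linearP.
have creat y k u e' : wspan (fun w => parity h w == e') u ->
    wspan (fun w => parity h w == e' (+) h y) (create (y, k) u).
  apply: wspan_linear => [|w' /eqP <-]; first exact: linearP.
  apply: (@wspan_word _ ((y, k) :: w')).
  by rewrite /parity /= oddD addbC oddb.
case: n => n; last exact/creat/wspan_word.
elim: w => [|[y k] w IH] /=.
  rewrite gen_vac.
  by case: (wspan_subspace (fun w => parity h w == parity h [::] (+) h x)).
have sub := wspan_subspace (fun w0 => parity h w0 == parity h ((y, k) :: w) (+) h x).
rewrite -[gen x n _](addrK (create (y, k) (gen x n (wvec w)))).
rewrite gen_car; apply: subspaceN => //.
  have /creat := IH => /(_ y k); apply: wspan_sub => w' /eqP ->.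
  by rewrite /parity /= oddD oddb; apply/eqP; rewrite addbC addbA.
case: ifP => [/andP[/eqP/= y_x _]|_]; last by case: sub.
apply: wspan_word; rewrite /parity /= oddD oddb y_x hd.
by rewrite addbAC addbb.
Qed.

Lemma wspan_full v : wspan predT v.
Proof.
(* With [pred0] the parity condition is void, and [wspan_parity_gen] says that the span of all words
   is stable under every mode; cyclicity of the vacuum concludes. *)
suff : wspan (fun w => parity pred0 w == false) v by apply: wspan_sub.
move: v; pose W := [set v | wspan (fun w => parity pred0 w == false) v]%classic.
suff WT : W = setT by move=> v; rewrite -[wspan _ v]/(W v) WT.
have [_ sub] := wspan_subspace (fun w => parity pred0 w == false).
apply: vac_cyclic => //.
- exact: (@wspan_word _ [::]).
- by move=> b p n v; apply: (@wspan_parity_gen pred0 false (Some (b, p))).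
- by move=> n v; apply: (@wspan_parity_gen pred0 false None).
Qed.

(** The cut-off that truncates the infinite mode sums on [v]. *)
Definition bounded (K : nat) (v : F) : Prop :=
  forall x (k : nat), (K <= k)%N -> gen x k v = 0.

Lemma boundedW K K' v : (K <= K')%N -> bounded K v -> bounded K' v.
Proof. by move=> KK' bv x k /(leq_trans KK'); apply: bv. Qed.

Definition level_lt (K : nat) (w : seq letter) : bool := all (fun a => a.2 < K)%N w.

Lemma bounded_word K w : level_lt K w -> bounded K (wvec w).
Proof.
elim: w => [_ x k _|[y j] w IH /= /andP[jK wK] x k Kk]; first exact: gen_vac.
apply/eqP; rewrite -[gen _ _ _](addrK (create (y, j) (gen x k (wvec w)))).
rewrite gen_car (IH wK) // linear0 subr0; case: ifP => // /andP[_ /eqP /=].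
rewrite NegzE; lia.
Qed.

Lemma bounded_sum K (s : seq (C * seq letter)) :
  all (level_lt K \o snd) s -> bounded K (\sum_(a <- s) a.1 *: wvec a.2).
Proof.
move=> /allP sK x k Kk; rewrite linear_sum big_seq big1 // => a /sK aK.
by rewrite linearZ_LR /= (bounded_word aK) // scaler0.
Qed.

Lemma level_bound (s : seq (seq letter)) : exists K, all (level_lt K) s.
Proof.
exists (\max_(a <- flatten s) a.2).+1; apply/allP => w ws; apply/allP => a aw.
rewrite ltnS (big_rem a) ?leq_maxl //; last by apply/flattenP; exists w.
Qed.

Lemma exists_bounded v : exists K, bounded K v.
Proof.
have [s [_ ->]] := wspan_full v.
have [K sK] := level_bound (map snd s).
by exists K; apply: bounded_sum; rewrite all_map in sK.
Qed.

Definition number_op (a : letter) (v : F) : F := create a (gen (dual_gen a.1) a.2 v).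

Lemma number_linear a : linear (number_op a).
Proof. by move=> c u v; rewrite /number_op !linearP. Qed.

(** Moving [number_op a] past a creation operator [create b] costs [create b] if [a = b] and nothing
    otherwise. Repeated letters need no separate treatment. *)
Lemma number_word a w : number_op a (wvec w) = (count_mem a w)%:R *: wvec w.
Proof.
elim: w => [|b w IH] /=; first by rewrite /number_op gen_vac linear0 scale0r.
rewrite /number_op [wvec _]/= /create.
have := gen_car (dual_gen a.1) b.1 a.2 (Negz b.2) (wvec w).
move/(canRL (addrK _)) => ->; rewrite linearB /=.
have := gen_car a.1 b.1 (Negz a.2) (Negz b.2) (gen (dual_gen a.1) a.2 (wvec w)).
rewrite [X in if X then _ else _](_ : _ = false); last by rewrite !NegzE; lia.
move/eqP; rewrite addr_eq0 => /eqP ->; rewrite opprK.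
rewrite -/(create a _) -/(number_op a _) IH linearZ_LR /= natrD scalerDl; congr (_ + _).
rewrite dual_genK (_ : (a.2%:Z + Negz b.2 + 1 == 0) = (b.2 == a.2)); last first.
  by rewrite NegzE; lia.
rewrite -[(b.1 == a.1) && _]/(b == a).
by case: eqP => [->|_]; rewrite ?scale1r // linear0 scale0r.
Qed.

Definition weight (c : I -> nat -> C) (w : seq letter) : C := \sum_(a <- w) c a.1 a.2.

Definition word_diagonal (T : F -> F) (e : seq letter -> C) : Prop :=
  linear T /\ forall w, T (wvec w) = e w *: wvec w.

(** The truncated formula is assumed for every admissible cut-off, so two vectors can share one;
    this yields linearity of [T]. *)
Lemma diagonal_number (T : F -> F) (c : I -> nat -> C) :
  (forall K v, bounded K v ->
     T v = \sum_x \sum_(k < K) c x k *: number_op (x, val k) v) ->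
  word_diagonal T (weight c).
Proof.
move=> TE; split=> [a u v|w].
  have [K uK] := exists_bounded u; have [K' vK] := exists_bounded v.
  have {}uK := boundedW (leq_maxl K K') uK; have {}vK := boundedW (leq_maxr K K') vK.
  have wK : bounded (maxn K K') (a *: u + v).
    by move=> x k h; rewrite linearP uK // vK // scaler0 addr0.
  rewrite !(TE _ _ uK, TE _ _ vK, TE _ _ wK) scaler_sumr -big_split.
  apply: eq_bigr => x _.
  rewrite scaler_sumr -big_split; apply: eq_bigr => k _.
  by rewrite number_linear scalerDr !scalerA [c x k * a]mulrC.
have [K] := level_bound [:: w]; rewrite /= andbT => wK.
rewrite (TE _ _ (bounded_word wK)) /weight scaler_suml.
transitivity (\sum_x \sum_(k < K) (\sum_(a <- w | a == (x, val k)) c a.1 a.2) *: wvec w).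
  apply: eq_bigr => x _; apply: eq_bigr => k _.
  rewrite number_word scalerA; congr (_ *: _).
  rewrite (eq_bigr (fun=> c x k)) => [|a /eqP -> //].
  by rewrite big_const_seq iter_addr_0 mulr_natr -sum1_count.
under eq_bigr do under eq_bigr do rewrite scaler_suml big_mkcond.
under eq_bigr do rewrite exchange_big.
rewrite exchange_big /= !big_seq; apply: eq_bigr => a aw.
have aK : (a.2 < K)%N by move/allP: wK; apply.
rewrite (bigD1 a.1) //= (bigD1 (Ordinal aK)) //= -surjective_pairing eqxx.
rewrite big1 => [|k ka]; last first.
  rewrite ifF //; apply: contraNF ka => /eqP ak; rewrite -(inj_eq val_inj) /=.
  by rewrite [X in _ == X.2]ak.
rewrite big1 ?addr0 // => x xa; rewrite big1 // => k _.
by rewrite ifF //; apply: contraNF xa => /eqP ->.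
Qed.

Lemma diagonal_scale a T e : word_diagonal T e ->
  word_diagonal (fun v => a *: T v) (fun w => a * e w).
Proof.
move=> [linT Te]; split=> [c u v|w]; last by rewrite Te scalerA.
by rewrite linT scalerDr !scalerA mulrC.
Qed.

Lemma diagonal_id : word_diagonal id (fun=> 1).
Proof. by split=> [//|w]; rewrite scale1r. Qed.

Lemma diagonal_add T T' e e' : word_diagonal T e -> word_diagonal T' e' ->
  word_diagonal (fun v => T v + T' v) (fun w => e w + e' w).
Proof.
move=> [linT Te] [linT' Te']; split=> [c u v|w]; last by rewrite Te Te' scalerDl.
by rewrite linT linT' scalerDr addrACA.
Qed.

Lemma diagonal_sum (J : Type) (r : seq J) (T : J -> F -> F) (e : J -> seq letter -> C) :
  (forall i, word_diagonal (T i) (e i)) ->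
  word_diagonal (fun v => \sum_(i <- r) T i v) (fun w => \sum_(i <- r) e i w).
Proof.
move=> Te; elim: r => [|i r IH].
  split=> [c u v|w]; rewrite !big_nil ?scale0r //.
  by rewrite scaler0 addr0.
have [linT TE] := diagonal_add (Te i) IH.
split=> [c u v|w]; rewrite !big_cons; [exact: linT|exact: TE].
Qed.

Lemma diagonal_wspan Q T e v : word_diagonal T e -> wspan Q v -> wspan Q (T v).
Proof.
move=> [linT Te]; apply: wspan_linear => // w Qw; rewrite Te.
have [Q0 Qs] := wspan_subspace Q.
by rewrite -[_ *: _]addr0; apply: Qs => //; apply: wspan_word.
Qed.

(** Keeping [Q] lets several eigenvalue conditions be imposed in turn on the same expression. *)
Lemma diagonal_eigen Q T e a v : word_diagonal T e -> wspan Q v -> T v = a *: v ->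
  wspan (fun w => Q w && (e w == a)) v.
Proof.
move=> [linT Te] [s [Qs ->]] Tv.
exists [seq b <- s | e b.2 == a]; split.
  by apply/allP => b; rewrite mem_filter /= => /andP[-> /(allP Qs) /= ->].
rewrite big_filter; apply: (@eigen_component _ _ T _ s (fun b => b.1 *: wvec b.2)
  (fun b => e b.2) a) => // b.
have [T' TT'] := linear_packed linT.
by rewrite TT' linearZ_LR /= -TT' Te !scalerA mulrC.
Qed.

Lemma diagonal_eigenP T e a v : word_diagonal T e ->
  T v = a *: v <-> wspan (fun w => e w == a) v.
Proof.
move=> dT; split=> [/(diagonal_eigen dT (wspan_full v))//|[s [/allP sa ->]]].
have [linT Te] := dT; have [T' TT'] := linear_packed linT.
rewrite TT' linear_sum scaler_sumr !big_seq; apply: eq_bigr => b /sa /= /eqP <-.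
by rewrite linearZ_LR /= -TT' Te !scalerA mulrC.
Qed.

End Words.

(** * Energy, charge, Cartan action and $\varphi$-parity *)

Section Operators.
Variables (R : realType) (l : nat) (F : fockSpace R l).
Local Notation C := (R[i]).
Local Notation I := (option (bool * 'I_l)).
Local Notation letter := (letter l).
Local Notation number_op := (@number_op R l F).

Lemma opm_Posz (k : nat) : opm k = Negz k.
Proof. by rewrite /opm NegzE; lia. Qed.

Lemma opm_Negz (k : nat) : opm (Negz k) = k.
Proof. by rewrite /opm NegzE; lia. Qed.

Lemma half_of_Negz (k : nat) : half_of R (Negz k) = - half_of R k.
Proof.
by rewrite /half_of NegzE -[in LHS]addn1 PoszD mulrNz rmorphD /=; field.
Qed.

Lemma sum_gen (V : zmodType) (G : I -> V) :
  \sum_x G x = \sum_p (G (Some (true, p)) + G (Some (false, p))) + G None.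
Proof.
rewrite (bigD1 None) //= addrC; congr (_ + _).
rewrite big_split -(big_bool _ (fun b => \sum_p G (Some (b, p)))) pair_big /=.
rewrite (reindex_omap Some id) /=; last by case.
by apply: eq_big => [[b p]|[b p] _] //; rewrite eqxx.
Qed.

Lemma sum_delta (V : lmodType C) (a : I) (G : I -> V) :
  \sum_x (x == a)%:R *: G x = G a.
Proof.
rewrite (bigD1 a) //= eqxx scale1r big1 ?addr0 // => x /negbTE ->.
by rewrite scale0r.
Qed.

Lemma number_bounded x K k v : bounded K v -> (K <= k)%N -> number_op (x, k) v = 0.
Proof. by move=> vK Kk; rewrite /number_op /= vK // linear0. Qed.

Lemma nord_creation x k v :
  nord (gen F x) (gen F (dual_gen x)) (Negz k) (Posz k) v = number_op (x, k) v.
Proof. by []. Qed.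

Lemma nord_annihilation x k v :
  nord (gen F x) (gen F (dual_gen x)) (Posz k) (Negz k) v = - number_op (dual_gen x, k) v.
Proof. by rewrite /nord /number_op /= /create /= dual_genK. Qed.

Lemma alpha_diagonal :
  word_diagonal (alpha (F := F)) (weight (fun x _ => (x == None)%:R)).
Proof.
apply: diagonal_number => K v vK; rewrite /alpha (@fsum_nonneg _ _ K); last first.
  by move=> k Kk; rewrite -[phi F k v]/(gen F None k v) vK // linear0.
rewrite exchange_big; apply: eq_bigr => k _.
by rewrite (sum_delta None (fun x => number_op (x, val k) v)) opm_Posz.
Qed.

(** For $\psi^-$ the sign of normal ordering cancels that of the negative mode, so every letter has
    positive energy. *)
Lemma energy_diagonal :
  word_diagonal (energy (F := F)) (weight (fun _ k => half_of R k)).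
Proof.
apply: diagonal_number => K v vK; rewrite /energy sum_gen; congr (_ + _).
  apply: eq_bigr => p _; rewrite (@fsum_int _ _ K) => [|k Kk|k Kk].
  - rewrite -big_split; apply: eq_bigr => k _ /=.
    rewrite opm_Posz opm_Negz half_of_Negz.
    have /= -> := nord_creation (Some (true, p)) k v.
    have /= -> := nord_annihilation (Some (true, p)) k v.
    by rewrite scalerN scaleNr opprK.
  - have /= := nord_creation (Some (true, p)) k v.
    by rewrite opm_Posz => ->; rewrite (number_bounded _ vK) // scaler0.
  - have /= := nord_annihilation (Some (true, p)) k v.
    by rewrite opm_Negz => ->; rewrite (number_bounded _ vK) // oppr0 scaler0.
rewrite (@fsum_nonneg _ _ K) => [|k Kk].
  by apply: eq_bigr => k _; rewrite opm_Posz.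
by rewrite -[phi F k v]/(gen F None k v) vK // linear0 scaler0.
Qed.

Definition charge (w : seq letter) : C :=
  weight (fun x _ => (if x is Some a then (-1) ^+ ~~ a.1 else 0)) w.

Lemma so_e_diagonal p :
  word_diagonal (so_e (F := F) p p)
    (weight (fun x _ => (x == Some (true, p))%:R - (x == Some (false, p))%:R)).
Proof.
apply: diagonal_number => K v vK; rewrite exchange_big /so_e (@fsum_int _ _ K) /=.
- apply: eq_bigr => k _; under [RHS]eq_bigr do rewrite scalerBl.
  rewrite sumrB !(sum_delta _ (fun x => number_op (x, val k) v)).
  rewrite opm_Posz opm_Negz addrC.
  by have /= -> := nord_annihilation (Some (true, p)) k v.
- move=> k Kk; rewrite opm_Posz.
  have /= -> := nord_annihilation (Some (true, p)) k v.
  by rewrite (number_bounded _ vK) // oppr0.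
- move=> k Kk; rewrite opm_Negz.
  have /= -> := nord_creation (Some (true, p)) k v.
  by rewrite (number_bounded _ vK).
Qed.

Lemma total_charge_diagonal : word_diagonal (fun v => \sum_p so_e (F := F) p p v) charge.
Proof.
have [linT Te] := diagonal_sum (index_enum 'I_l) so_e_diagonal.
split=> // w; rewrite Te; congr (_ *: _); rewrite exchange_big.
apply: eq_bigr => a _; case: a => [[[b q]|] k] /=; last first.
  by rewrite big1 // => p _; rewrite subrr.
rewrite (bigD1 q) //= big1 => [|p pq].
  by rewrite addr0; case: b; rewrite /= ?eqxx ?subr0 ?sub0r.
by rewrite -![Some _ == _]/((_ == _) && (_ == _)) [q == p]eq_sym (negbTE pq) !andbF subrr.
Qed.

Lemma fock_E_diag_pos (k : nat) v :
  fock_E k.+1%:Z k.+1%:Z v = \sum_x number_op (x, k) v.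
Proof.
rewrite /fock_E sum_gen -[- _]/(Negz k) (_ : k.+1%:Z - 1 = k); last by lia.
congr (_ + _); apply: eq_bigr => p _; congr (_ + _).
Qed.

Lemma fock_E_diag_neg (k : nat) v :
  fock_E (- k%:Z) (- k%:Z) v = - \sum_x number_op (x, k) v.
Proof.
rewrite /fock_E sum_gen opprK opprD (_ : - k%:Z - 1 = Negz k); last by rewrite NegzE; lia.
have /= -> := nord_annihilation None k v; congr (_ + _).
rewrite -sumrN; apply: eq_bigr => p _.
have /= -> := nord_annihilation (Some (true, p)) k v.
have /= -> := nord_annihilation (Some (false, p)) k v.
by rewrite addrC -opprD.
Qed.

Lemma fock_act_diagonal (x : dpair R) : d_cartan x ->
  word_diagonal (fock_act (F := F) x)
    (fun w => weight (fun _ k => x.1 k.+1%:Z k.+1%:Z) w + x.2 * (l%:R + 2^-1)).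
Proof.
move=> [[_ xN] x0].
have dA : word_diagonal (fun v : F => 2^-1 *: \sum_(ij \in [set: int * int])
    x.1 ij.1 ij.2 *: fock_E ij.1 ij.2 v) (weight (fun _ k => x.1 k.+1%:Z k.+1%:Z)).
  apply: diagonal_number => K v vK.
  rewrite fsum_diag => [|i j /x0 /= ->]; last by rewrite scale0r.
  (* The shift sends [Posz k] to [k + 1] and [Negz k] to [- k]. These positions are exchanged by
     $i\mapsto 1-i$; their equal contributions absorb the factor 1/2. *)
  pose h (i : int) := i + 1.
  have hb : set_bij [set: int]%classic [set: int]%classic h.
    split=> // [i j _ _ /addIr //|i _]; exists (i - 1) => //.
    by rewrite /h subrK.
  rewrite (reindex_fsbig h _ _ _ hb) /=.
  have hP (k : nat) : h k = k.+1%:Z by rewrite /h; lia.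
  have hN (k : nat) : h (Negz k) = - k%:Z by rewrite /h NegzE; lia.
  rewrite exchange_big (@fsum_int _ _ K) => [|k Kk|k Kk].
  - rewrite scaler_sumr; apply: eq_bigr => k _.
    rewrite hP hN fock_E_diag_pos fock_E_diag_neg.
    rewrite (xN (- _)) opprK (_ : 1 + k%:Z = k.+1%:Z); last by lia.
    rewrite scaleNr scalerN opprK -scalerDl scalerA -scaler_sumr; congr (_ *: _).
    by field.
  - by rewrite hP fock_E_diag_pos big1 ?scaler0 // => y _; apply: number_bounded vK _.
  - rewrite hN fock_E_diag_neg big1 ?oppr0 ?scaler0 // => y _.
    exact: number_bounded vK _.
have dC := diagonal_scale (x.2 * (l%:R + 2^-1)) (diagonal_id F).
have [linT Te] := diagonal_add dA dC.
by split=> [//|w]; rewrite [LHS]Te mulr1.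
Qed.

Definition phi_parity (w : seq letter) : bool := parity (fun x => x == None) w.

(** Each term is a product of two modes of dual species: either both are $\varphi$ or neither is. *)
Lemma fock_act_parity (x : dpair R) e v :
  wspan (F := F) (fun w => phi_parity w == e) v ->
  wspan (F := F) (fun w => phi_parity w == e) (fock_act x v).
Proof.
have sub := wspan_subspace F (fun w => phi_parity w == e).
have [P0 Plin] := sub; move=> ve.
have genP y n e' u : wspan (F := F) (fun w => phi_parity w == e') u ->
    wspan (fun w => phi_parity w == e' (+) (y == None)) (gen F y n u).
  by apply: wspan_parity_gen => -[[]|].
have nordP y m n : wspan (fun w => phi_parity w == e)
    (nord (gen F y) (gen F (dual_gen y)) m n v).
  have dy : (dual_gen y == None) = (y == None) by case: y => [[]|].
  rewrite /nord; case: ifP => _.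
    rewrite -scaleN1r -[_ *: _]addr0; apply: Plin => //.
    have /(genP (dual_gen y) n) := genP y m _ _ ve.
    by apply: wspan_sub => w; rewrite dy addbK.
  have /(genP y m) := genP (dual_gen y) n _ _ ve.
  by apply: wspan_sub => w; rewrite dy addbK.
have PD u u' : wspan (fun w => phi_parity w == e) u ->
    wspan (fun w => phi_parity w == e) u' ->
    wspan (F := F) (fun w => phi_parity w == e) (u + u').
  by move=> hu hu'; rewrite -[u]scale1r; apply: Plin.
rewrite /fock_act; apply: (PD); last by rewrite -[_ *: v]addr0; apply: Plin.
rewrite -[_ *: _]addr0; apply: Plin => //; apply: subspace_sum => // -[i j] _.
rewrite /fock_E; apply: (PD); last exact: (nordP None).
elim/big_rec: _ => // p u _ hu; apply: (PD) => //; apply: (PD).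
  exact: (nordP (Some (true, p))).
exact: (nordP (Some (false, p))).
Qed.

Lemma unit_zmx_flip (a i j : int) :
  unit_zmx R a a (1 - j) (1 - i) = unit_zmx R (1 - a) (1 - a) i j.
Proof.
rewrite /unit_zmx andbC; congr ((_ && _)%:R); lia.
Qed.

Lemma unit_zmx_offdiag (a i j : int) : i != j -> unit_zmx R a a i j = 0.
Proof.
rewrite /unit_zmx => ij; case: andP => // -[/eqP ia /eqP ja].
by rewrite ia ja eqxx in ij.
Qed.

Lemma d_cartan_pair (A : zmx R) (c : C) :
  (forall i j, i != j -> A i j = 0) -> (forall i j, A i j = - A (1 - j) (1 - i)) ->
  d_cartan (A, c).
Proof.
move=> A0 AN; split=> //; split=> //; exists 0%N => i j /= ij.
by apply: A0; apply: contraTneq ij => ->; rewrite subrr.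
Qed.

Lemma Dd_cartan (s : C) : d_cartan (Dd s).
Proof.
apply: d_cartan_pair => [i j ij|i j].
  apply: fsbig1 => k _.
  by rewrite /sub_zmx !unit_zmx_offdiag // subrr mulr0.
rewrite -[RHS]mulN1r mulr_fsumr; apply: eq_fsbigr => k _.
rewrite /sub_zmx !unit_zmx_flip subKr; ring.
Qed.

Lemma Hd_cartan (k : nat) : d_cartan (Hd R k.+1).
Proof.
apply: d_cartan_pair => i j => [ij|].
  by rewrite /sub_zmx /add_zmx !unit_zmx_offdiag // addr0 !subr0.
rewrite /sub_zmx /add_zmx !unit_zmx_flip.
rewrite (_ : 1 - (k.+1%:Z + 1) = - k.+1%:Z); last by lia.
rewrite (_ : 1 - (- k.+1%:Z + 1) = k.+1%:Z); last by lia.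
rewrite (_ : 1 - - k.+1%:Z = k.+1%:Z + 1); last by lia.
rewrite (_ : 1 - k.+1%:Z = - k.+1%:Z + 1); last by lia.
ring.
Qed.

Lemma Hd_diag (k j : nat) :
  (Hd R k.+1).1 j.+1%:Z j.+1%:Z = (j == k)%:R - (j == k.+1)%:R.
Proof.
rewrite /= /sub_zmx /add_zmx /unit_zmx !andbb.
rewrite (_ : (j.+1%:Z == k.+1%:Z) = (j == k)); last by lia.
rewrite (_ : (j.+1%:Z == - k.+1%:Z) = false); last by lia.
rewrite (_ : (j.+1%:Z == k.+1%:Z + 1) = (j == k.+1)); last by lia.
rewrite (_ : (j.+1%:Z == - k.+1%:Z + 1) = false); last by lia.
by rewrite addr0 subr0.
Qed.

(** A letter of level [j] has eigenvalue 1 under $H_{j+1}$ and -1 under $H_j$ (for $j\ge1$), so it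
    contributes $(j+1)-j=1$. *)
Lemma Hd_weighted_sum (j K : nat) : (j < K)%N ->
  \sum_(k < K) k.+1%:R * ((j == k)%:R - (j == k.+1)%:R) = 1 :> C.
Proof.
move=> jK; under eq_bigr do rewrite mulrBr.
rewrite sumrB (bigD1 (Ordinal jK)) //= eqxx mulr1 big1 ?addr0; last first.
  move=> k kj; rewrite (_ : _ == _ = false) ?mulr0 //.
  by apply: contraNF kj => /eqP jk; apply/eqP/val_inj.
case: j jK => [|j] jK.
  by rewrite big1 ?subr0 // => k _; rewrite mulr0.
have jK' := ltnW jK; rewrite (bigD1 (Ordinal jK')) //= eqxx mulr1 big1.
  by rewrite addr0 -natrB // subSnn.
move=> k kj; rewrite (_ : _ == _ = false) ?mulr0 //.
by apply: contraNF kj => /eqP[jk]; apply/eqP/val_inj.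
Qed.

Definition is_plus (a : letter) : bool := if a.1 is Some (true, _) then true else false.
Definition is_minus (a : letter) : bool := if a.1 is Some (false, _) then true else false.
Definition is_phi (a : letter) : bool := a.1 == None.

Lemma charge_count (w : seq letter) :
  charge w = (count is_plus w)%:R - (count is_minus w)%:R.
Proof.
rewrite /charge /weight; elim: w => [|[[[[] p]|] k] w IH].
- by rewrite big_nil subrr.
- by rewrite big_cons IH /= expr0 add1n add0n -natr1; ring.
- by rewrite big_cons IH /= expr1 add1n add0n -natr1; ring.
- by rewrite big_cons IH /= !add0n add0r.
Qed.

Lemma size_count (w : seq letter) :
  size w = (count is_plus w + count is_minus w + count is_phi w)%N.
Proof.
elim: w => // [[[[[] p]|] k] w /= ->]; rewrite /is_plus /is_minus /is_phi /=; lia.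
Qed.

(* On the span of the words of modes below [K], the operator                  *)
(* [\sum_(1 <= k <= K) k H_k] telescopes to the number of letters.            *)
Lemma hw_parity (lam : l.-tuple nat) (Lam : nat -> nat) (S : nat) (v : F) :
  (forall p, so_e p p v = (tnth lam p)%:R *: v) ->
  (forall k, fock_act (Hd R k.+1) v = (Lam k.+1)%:R *: v) ->
  (exists K0, forall K, (K0 <= K)%N -> \sum_(k < K) k.+1 * Lam k.+1 = S)%N ->
  wspan (fun w => phi_parity w == odd (S + sumn lam)) v.
Proof.
move=> Qv Hv [K0 SE]; have [s [_ vE]] := wspan_full v.
have [K1 sK1] := level_bound (map snd s).
(* Large enough both for the weighted sum of [Lam] to equal [S] and for all letters occurring in
   [v]. *)
pose K := maxn K0 K1.
have vK : wspan (level_lt K) v.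
  exists s; split=> //; rewrite all_map in sK1; apply: sub_all sK1 => a /=.
  by apply: sub_all => b /= /leq_trans; apply; apply: leq_maxr.
pose N u := \sum_(k < K) k.+1%:R *: fock_act (Hd R k.+1) u : F.
have dN := diagonal_sum (index_enum 'I_K) (fun k : 'I_K =>
  diagonal_scale k.+1%:R (fock_act_diagonal (Hd_cartan k))).
have Nv : N v = S%:R *: v.
  rewrite /N; under eq_bigr do rewrite Hv scalerA -natrM.
  by rewrite -scaler_suml -natr_sum SE // leq_maxl.
have Cv : \sum_p so_e p p v = (sumn lam)%:R *: v.
  under eq_bigr do rewrite Qv.
  by rewrite -scaler_suml -natr_sum sumnE big_tuple.
have := diagonal_eigen dN vK Nv.
move=> /(diagonal_eigen total_charge_diagonal)/(_ Cv).
apply: wspan_sub => w /andP[/andP[wK /eqP wS] /eqP wC].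
have sizeS : size w = S.
  apply/eqP; rewrite -(eqr_nat C) -wS.
  under eq_bigr => k _ do
    rewrite (_ : (Hd R k.+1).2 = 0) // mul0r addr0 /weight mulr_sumr.
  rewrite exchange_big -sum1_size natr_sum !big_seq; apply/eqP/eq_bigr => a aw.
  under eq_bigr do rewrite Hd_diag.
  by rewrite Hd_weighted_sum //; move/allP: wK; apply.
have plus : (count is_plus w = sumn lam + count is_minus w)%N.
  apply/eqP; rewrite -(eqr_nat C) natrD -subr_eq -charge_count.
  exact/eqP.
(* The count reads $S=|\lambda|+2\,\#\psi^-+\#\varphi$. *)
rewrite /phi_parity -[parity _ w]/(odd (count is_phi w)) -sizeS size_count plus.
lia.
Qed.

(** Grouping the words by their number of $\varphi$ gives an eigenvector decomposition to which
    [sign_pow_eq] applies. *)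
Lemma sign_pow_alpha (s : seq (C * seq letter)) :
  sign_pow (alpha (F := F)) (\sum_(a <- s) a.1 *: wvec F a.2) =
  \sum_(a <- s) (-1) ^+ phi_parity a.2 *: (a.1 *: wvec F a.2).
Proof.
have [linA Ae] := alpha_diagonal.
have alphaE w : alpha (wvec F w) = (count is_phi w)%:R *: wvec F w.
  rewrite Ae /weight -sum1_count natr_sum [in RHS]big_mkcond; congr (_ *: _).
  by apply: eq_bigr => a _; rewrite /is_phi; case: eqP.
pose N := (\max_(a <- s) count is_phi a.2).+1.
have sN a : a \in s -> (count is_phi a.2 < N)%N.
  by move=> as_; rewrite ltnS (big_rem a) // leq_maxl.
have partE (c : nat -> C) :
    \sum_(k < N) c k *: (\sum_(a <- s | count is_phi a.2 == k) a.1 *: wvec F a.2)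
    = \sum_(a <- s) c (count is_phi a.2) *: (a.1 *: wvec F a.2).
  under eq_bigr do rewrite big_mkcond scaler_sumr.
  rewrite exchange_big /= !big_seq; apply: eq_bigr => a /sN aN.
  rewrite (bigD1 (Ordinal aN)) //= eqxx big1 ?addr0 // => k ka.
  rewrite ifF ?scaler0 //; apply: contraNF ka => /eqP ak.
  exact/eqP/val_inj.
have [T TT] := linear_packed linA.
have := @sign_pow_eq _ _ _ N
  (fun k => \sum_(a <- s | count is_phi a.2 == k) a.1 *: wvec F a.2) linA.
rewrite (partE (fun k => (-1) ^+ k)).
have := partE (fun=> 1); under eq_bigr do rewrite scale1r.
under [RHS]eq_bigr do rewrite scale1r.
move=> -> -> => [|k].
  by apply: eq_bigr => a _; rewrite -signr_odd.
rewrite TT linear_sum scaler_sumr; apply: eq_bigr => a /eqP <-.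
by rewrite linearZ_LR /= -TT alphaE !scalerA mulrC.
Qed.

Lemma sign_pow_parity u v :
  wspan (fun w => phi_parity w == false) u -> wspan (fun w => phi_parity w == true) v ->
  sign_pow (alpha (F := F)) (u + v) = u - v.
Proof.
move=> [s [/allP s0 ->]] [s' [/allP s1 ->]]; rewrite -big_cat sign_pow_alpha big_cat /=.
rewrite -sumrN; congr (_ + _); rewrite !big_seq; apply: eq_bigr => a.
  by move=> /s0 /= /eqP ->; rewrite scale1r.
by move=> /s1 /= /eqP ->; rewrite expr1 scaleN1r.
Qed.

(** Applying $(-1)^\alpha$ to $u+v=0$ gives $u-v=0$ as well, hence $2u=0$. *)
Lemma wspan_parity_disjoint u v :
  wspan (fun w => phi_parity w == false) u -> wspan (fun w => phi_parity w == true) v ->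
  u + v = 0 :> F -> u = 0 /\ v = 0.
Proof.
move=> u0 v1 uv; suff u_0 : u = 0 by move: uv; rewrite u_0 add0r.
have [z0 _] := wspan_subspace F (fun w => phi_parity w == false).
have [z1 _] := wspan_subspace F (fun w => phi_parity w == true).
have := sign_pow_parity u0 v1; rewrite uv.
have := sign_pow_parity z0 z1; rewrite addr0 subr0 => -> /esym uv'.
have : 2%:R *: u = 0.
  rewrite -[2%:R]/(1 + 1 : C) scalerDl scale1r; transitivity ((u + v) + (u - v)).
    by rewrite addrACA subrr addr0.
  by rewrite uv uv' addr0.
by move/eqP; rewrite scaler_eq0 pnatr_eq0 => /eqP.
Qed.

Fixpoint words (ls : seq letter) (n : nat) : seq (seq letter) :=
  if n is n'.+1 then [::] :: [seq a :: w | a <- ls, w <- words ls n'] else [:: [::]].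

Lemma mem_words (ls : seq letter) n w :
  (size w <= n)%N -> all (mem ls) w -> w \in words ls n.
Proof.
elim: n w => [|n IH] [|a w] //= wn /andP[als wls].
by rewrite inE /= allpairs_f // IH.
Qed.

(** A letter of level [k] has energy $k+\frac12$, so a word of energy $m/2$ has at most [m] letters,
    all of level at most [m]. There are finitely many such words. *)
Lemma energy_eigenspace_finite (m : nat) : exists g : seq F,
  forall v, energy v = (m%:R / 2) *: v -> in_span g v.
Proof.
pose ls := [seq (x, k) | x <- enum {: I}, k <- iota 0 m.+1].
exists (map (wvec F) (words ls m)) => v.
move=> /(diagonal_eigenP _ _ energy_diagonal) [s [/allP sm ->]].
rewrite big_seq; elim/big_rec: _ => [|a u /sm /= /eqP wm].
  exact: in_span0.
apply: in_span_lincomb; apply: in_span_mem; apply: map_f.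
have {}wm : (\sum_(b <- a.2) (b.2.*2.+1) = m)%N.
  apply/eqP; rewrite -(eqr_nat C) natr_sum -[m%:R](@mulfVK _ 2) ?pnatr_eq0 //.
  rewrite -wm /weight mulr_suml; apply/eqP/eq_bigr => b _.
  by rewrite /half_of -addn1 natrD -mul2n natrM pmulrn; field.
apply: mem_words.
  rewrite -wm -sum1_size; exact: leq_sum.
apply/allP => b ba; rewrite inE.
apply/allpairsP; exists b; rewrite -surjective_pairing mem_enum; split=> //.
rewrite mem_iota /= add0n ltnS -wm (big_rem b) //=.
by apply: leq_trans (leq_addr _ _); rewrite -addnn; lia.
Qed.

End Operators.

(** * The sums $\sum_k k\,\Lambda(H_k)$ *)

Section HighestWeights.
Implicit Types (lam : seq nat) (K m : nat).

Lemma sum_fund_wt K m : (m <= K)%N -> (\sum_(k < K) k.+1 * fund_wt m k.+1 = m)%N.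
Proof.
rewrite /fund_wt; case: m => [_|m mK]; first by rewrite big1 // => k _; rewrite muln0.
rewrite (bigD1 (Ordinal mK)) //= eqxx muln1 big1 ?addn0 // => k km.
rewrite (_ : _ == _ = false) ?muln0 //.
by apply: contraNF km => /eqP[km]; apply/eqP/val_inj.
Qed.

(** Each $\Lambda^d_m$ contributes [m], so the coefficient of $\Lambda^d_0$ disappears. *)
Lemma sum_weight K lam (a b : nat) : (0 < K)%N -> all (fun m => m <= K)%N lam ->
  (\sum_(k < K) k.+1 * (a * fund_wt 0 k.+1 + b * fund_wt 1 k.+1
    + \sum_(m <- lam | 1 < m) fund_wt m k.+1) = b + \sum_(m <- lam | 1 < m) m)%N.
Proof.
move=> K0 /allP lamK.
rewrite (eq_bigr (fun k : 'I_K => b * (k.+1 * fund_wt 1 k.+1) +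
    \sum_(m <- lam | 1 < m) k.+1 * fund_wt m k.+1)%N); last first.
  by move=> k _; rewrite -big_distrr /= -mulnCA -mulnDr /fund_wt muln0.
rewrite big_split /=; congr (_ + _)%N.
  by rewrite -big_distrr /= sum_fund_wt // muln1.
rewrite exchange_big /= big_seq_cond [RHS]big_seq_cond.
by apply: eq_bigr => m /andP[/lamK mK _]; rewrite sum_fund_wt.
Qed.

Lemma sumn_parts lam :
  (sumn lam = (parts_gt0 lam - parts_gt1 lam) + \sum_(m <- lam | 1 < m) m)%N.
Proof.
have le01 : (parts_gt1 lam <= parts_gt0 lam)%N by apply: sub_count => m /ltnW.
suff : (sumn lam + parts_gt1 lam = parts_gt0 lam + \sum_(m <- lam | 1 < m) m)%N by lia.
rewrite /parts_gt0 /parts_gt1 {le01}; elim: lam => [|m lam IH]; first by rewrite big_nil.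
by rewrite big_cons /=; case: ifP => /=; lia.
Qed.

Lemma sumn_bound lam K : (sumn lam < K)%N -> all (fun m => m <= K)%N lam.
Proof.
move=> lamK; apply/allP => m mlam.
by move: lamK; rewrite sumnE (big_rem m) //=; lia.
Qed.

Lemma Lam_part_sum l lam K : (sumn lam < K)%N ->
  (\sum_(k < K) k.+1 * Lam_part l lam k.+1 = sumn lam)%N.
Proof.
move=> lamK; rewrite sum_weight ?sumn_bound //; last by lia.
by rewrite -sumn_parts.
Qed.

(** The sum is $|\lambda|+2l+1-2j$, with [j] the number of non-zero parts; that term is moved across
    to avoid truncated subtraction. As [lam] has length [l], the coefficient $2l+1-i-j$ is not
    truncated either. *)
Lemma Lam_part_det_sum l (lam : l.-tuple nat) K : (sumn lam < K)%N ->
  (\sum_(k < K) k.+1 * Lam_part_det l lam k.+1 + 2 * parts_gt0 lam =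
   sumn lam + (2 * l + 1))%N.
Proof.
move=> lamK; rewrite sum_weight ?sumn_bound //; last by lia.
have le01 : (parts_gt1 lam <= parts_gt0 lam)%N by apply: sub_count => m /ltnW.
have := count_size (fun m => 0 < m)%N lam; rewrite size_tuple -/(parts_gt0 lam).
rewrite [sumn lam]sumn_parts; lia.
Qed.

End HighestWeights.

(** * Irreducible modules realized in the Fock space *)

Section Realization.
Variables (R : realType) (l : nat) (F : fockSpace R l).
Local Notation C := (R[i]).

Lemma fock_D_prod_wspan Q (s : seq C) (v : F) :
  wspan Q v -> wspan Q (fock_D_prod s v).
Proof.
move=> Qv; elim: s => //= a s IH.
exact: diagonal_wspan (fock_act_diagonal F (Dd_cartan a)) IH.
Qed.

Lemma fock_D_prod_linear (s : seq C) : linear (@fock_D_prod R l F s).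
Proof.
move=> c u v; elim: s => //= a s ->.
by have [->] := fock_act_diagonal F (Dd_cartan a).
Qed.

Variables (L : dinfModule R) (f : {linear L -> F}).
Hypothesis equiv : is_equivariant f.

Lemma D_prod_linear (s : seq C) : linear (@D_prod R L s).
Proof. by move=> c u v; elim: s => //= a s ->; rewrite linearP. Qed.

Lemma equivariant_D_prod (s : seq C) u : f (D_prod s u) = fock_D_prod s (f u).
Proof. by elim: s => //= a s <-; rewrite equiv //; case: (Dd_cartan a). Qed.

(** The vectors whose image has this parity form a submodule, which contains the highest weight
    vector and is therefore everything. *)
Lemma realized_parity (lam : l.-tuple nat) (Lam : nat -> nat) (c : C) (S : nat) :
  is_irr_hw_module L Lam c -> (forall u, M_space F lam (f u)) ->
  (exists K0, forall K, (K0 <= K)%N -> \sum_(k < K) k.+1 * Lam k.+1 = S)%N ->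
  forall u, wspan (fun w => phi_parity w == odd (S + sumn lam)) (f u).
Proof.
move=> [[_ irr] [v [v0 _ _ Hv _]]] fM SE.
set P := wspan _; pose W : set L := [set u | P (f u)]%classic.
have [P0 Plin] := wspan_subspace F (fun w => phi_parity w == odd (S + sumn lam)).
have subW : is_dsubmodule W.
  split=> [|a u u' Wu Wu'|x u dx Wu]; rewrite /W /=.
  - by rewrite linear0.
  - by rewrite linearP; apply: Plin.
  - by rewrite equiv //; apply: fock_act_parity.
have [Qv _ _ _] := fM v.
have Wv : W v.
  apply: hw_parity SE => // k; rewrite -equiv; last by case: (Hd_cartan R k).
  by rewrite Hv linearZ_LR.
have [W0|WT] := irr W subW; last by move=> u; rewrite -[P _]/(W u) WT.
by move: Wv v0; rewrite W0 => /= ->; rewrite eqxx.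
Qed.

Definition energy_space (m : nat) : set L :=
  [set v : L | energy (f v) = (m%:R / 2) *: f v]%classic.

Lemma energy_space_subspace m : subspace (energy_space m).
Proof.
have [linE _] := energy_diagonal F; have [E EE] := linear_packed linE.
split=> [|c u v]; rewrite /energy_space /=; first by rewrite EE !linear0.
by move=> Eu Ev; rewrite linearP linE Eu Ev scalerDr !scalerA mulrC.
Qed.

Lemma D_prod_energy_space m s u : energy_space m u -> energy_space m (D_prod s u).
Proof.
rewrite /energy_space /= equivariant_D_prod.
move=> /(diagonal_eigenP _ _ (energy_diagonal F)) Eu.
exact/(diagonal_eigenP _ _ (energy_diagonal F))/fock_D_prod_wspan.
Qed.

Hypothesis injf : forall u, f u = 0 -> u = 0.

(** The image in [F] lies in a finite span, and injectivity of [f] pulls a basis of it back to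
    [L]. *)
Lemma energy_space_basis m : exists d (e : 'I_d -> L), is_basis (energy_space m) e.
Proof.
have [g gE] := energy_eigenspace_finite F m.
pose U : set F := [set w | exists2 u, energy_space m u & w = f u]%classic.
have [E0 Elin] := energy_space_subspace m.
have sU : subspace U.
  split; first by exists 0 => //; rewrite linear0.
  move=> c _ _ [u Eu ->] [v Ev ->]; exists (c *: u + v); first exact: Elin.
  by rewrite linearP.
have [|d [e' e'U]] := finite_span_basis sU (g := g).
  by move=> _ [u Eu ->]; apply: gE.
have [e eE] := choice (fun i => let: ex_intro2 u h h' := e'U.1 i in
  ex_intro (fun u => energy_space m u /\ e' i = f u) u (conj h h')).
have fsum (x : 'rV[C]_d) : f (\sum_i x 0 i *: e i) = \sum_i x 0 i *: e' i.
  by rewrite linear_sum; apply: eq_bigr => i _; rewrite linearZ_LR /= (eE i).2.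
exists d, e; apply: is_basisP => [i|v Ev|x]; first exact: (eE i).1.
  have [x [vx _]] := e'U.2 _ (ex_intro2 _ _ v Ev erefl).
  exists x; apply/eqP; rewrite -subr_eq0; apply/eqP/injf.
  by rewrite linearB fsum /= vx subrr.
by move/(congr1 f); rewrite fsum linear0; apply: basis_free sU e'U.
Qed.

Lemma realized_trace m s : exists d (e : 'I_d -> L) (A : 'M[C]_d),
  [/\ is_basis (energy_space m) e, (forall i, D_prod s (e i) = \sum_j A i j *: e j) &
      frakD f s m = \tr A].
Proof.
have [d [e eU]] := energy_space_basis m; exists d, e.
have [y yE] := choice (fun i => let: ex_intro y (conj h _) :=
  eU.2 _ (D_prod_energy_space s (eU.1 i)) in ex_intro (fun y : 'rV[C]_d =>
    D_prod s (e i) = \sum_j y 0 j *: e j) y h).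
pose A : 'M[C]_d := \matrix_(i, j) y i 0 j.
have AE i : D_prod s (e i) = \sum_j A i j *: e j.
  by rewrite yE; apply: eq_bigr => j _; rewrite mxE.
exists A; split=> //; apply: trace_on_eq eU AE; first exact: energy_space_subspace.
by move=> c u v _ _; apply: D_prod_linear.
Qed.

End Realization.

(** * The sum and the difference of the two traces *)

Theorem proposition3p2 (R : realType) (l n : nat) (lam : l.-tuple nat)
    (s : n.-tuple R[i]) (F : fockSpace R l) (L Ldet : dinfModule R)
    (f : {linear L -> F}) (fdet : {linear Ldet -> F})
    (hl : (1 <= l)%N) (hn : (1 <= n)%N) (hlam : sorted geq lam)
    (hs : forall a : 'I_n, tnth s a != 0 /\ tnth s a ^+ 2 != 1)
    (hL : is_irr_hw_module L (Lam_part l lam) (l%:R + 2^-1))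
    (hLdet : is_irr_hw_module Ldet (Lam_part_det l lam) (l%:R + 2^-1))
    (hM : realizes_M lam f fdet) :
  (forall m : nat,
     frakD f s m = (bbD F lam s m + bbD_bar F lam s m) / 2) /\
  (forall m : nat,
     frakD fdet s m = (bbD F lam s m - bbD_bar F lam s m) / 2).
Proof.
have [eqf eqd inj ME] := hM.
have fM u : M_space F lam (f u) by rewrite ME; exists u, 0; rewrite linear0 addr0.
have dM u : M_space F lam (fdet u) by rewrite ME; exists 0, u; rewrite linear0 add0r.
have f_even u : wspan (fun w => phi_parity w == false) (f u).
  have := realized_parity eqf hL fM (S := sumn lam).
  rewrite addnn odd_double; apply; exists (sumn lam).+1 => K; exact: Lam_part_sum.
have d_odd u : wspan (fun w => phi_parity w == true) (fdet u).
  pose S := (sumn lam + (2 * l + 1) - 2 * parts_gt0 lam)%N.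
  have -> : true = odd (S + sumn lam).
    have := Lam_part_det_sum (ltnSn (sumn lam)).
    rewrite {}/S; lia.
  apply: (realized_parity eqd hLdet dM); exists (sumn lam).+1 => K.
  by move/Lam_part_det_sum; rewrite /S; lia.
have injf u : f u = 0 -> u = 0.
  by move=> fu; have [] := inj u 0; rewrite ?fu ?linear0 ?addr0.
have injd u : fdet u = 0 -> u = 0.
  by move=> fu; have [] := inj 0 u; rewrite ?fu ?linear0 ?addr0.
have DE u v : fock_D_prod s (f u + fdet v) = f (D_prod s u) + fdet (D_prod s v).
  have := fock_D_prod_linear (F := F) s 1 (f u) (fdet v); rewrite !scale1r => ->.
  by rewrite -!equivariant_D_prod.
have traces m : bbD F lam s m = frakD f s m + frakD fdet s m /\
                bbD_bar F lam s m = frakD f s m - frakD fdet s m.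
  have [d1 [e1 [A1 [e1U A1E ->]]]] := realized_trace eqf injf m s.
  have [d2 [e2 [A2 [e2U A2E ->]]]] := realized_trace eqd injd m s.
  set U := (M_space F lam `&` [set v | energy v = (m%:R / 2) *: v])%classic.
  have [linE _] := energy_diagonal F; have [E EE] := linear_packed linE.
  (* Energy preserves the $\varphi$-parity, so the eigenvalue equation splits into its even and odd
     parts. *)
  have UE w : U w <-> exists u v,
      [/\ energy_space f m u, energy_space fdet m v & w = f u + fdet v].
    split=> [[]|[u [v [Eu Ev ->]]]].
      rewrite ME => -[u [v ->]] /= Ew; exists u, v.
      have [] := @wspan_parity_disjoint _ _ F (energy (f u) - (m%:R / 2) *: f u)
                 (energy (fdet v) - (m%:R / 2) *: fdet v).
      - have [_ sub] := wspan_subspace F (fun w => phi_parity w == false).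
        rewrite addrC -scaleNr; apply: sub => //.
        exact: diagonal_wspan (energy_diagonal F) _.
      - have [_ sub] := wspan_subspace F (fun w => phi_parity w == true).
        rewrite addrC -scaleNr; apply: sub => //.
        exact: diagonal_wspan (energy_diagonal F) _.
      - by rewrite addrACA -opprD -scalerDr -Ew !EE linearD subrr.
      by move=> /eqP + /eqP; rewrite !subr_eq0 => /eqP Eu /eqP Ev.
    split; first by rewrite ME; exists u, v.
    by rewrite /= EE linearD -!EE Eu Ev scalerDr.
  have sU : subspace U.
    have [E10 E1] := energy_space_subspace f m.
    have [E20 E2] := energy_space_subspace fdet m.
    split; first by apply/UE; exists 0, 0; rewrite !linear0 addr0.
    move=> c _ _ /UE[u [v [Eu Ev ->]]] /UE[u' [v' [Eu' Ev' ->]]].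
    apply/UE; exists (c *: u + u'), (c *: v + v'); split; [exact: E1|exact: E2|].
    by rewrite !linearP scalerDr addrACA.
  pose e (i : 'I_(d1 + d2)) : F :=
    match fintype.split i with inl j => f (e1 j) | inr j => fdet (e2 j) end.
  have el j : e (lshift d2 j) = f (e1 j) by rewrite /e (unsplitK (inl j)).
  have er j : e (rshift d1 j) = fdet (e2 j) by rewrite /e (unsplitK (inr j)).
  have esum (x : 'rV[R[i]]_(d1 + d2)) : \sum_i x 0 i *: e i =
      f (\sum_i lsubmx x 0 i *: e1 i) + fdet (\sum_i rsubmx x 0 i *: e2 i).
    rewrite big_split_ord !linear_sum; congr (_ + _); apply: eq_bigr => i _.
      by rewrite linearZ_LR el mxE.
    by rewrite linearZ_LR er mxE.
  have eU : is_basis U e.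
    apply: is_basisP => [i|w /UE[u [v [Eu Ev ->]]]|x].
    - apply/UE; rewrite -(fintype.splitK i); case: (fintype.split i) => j /=.
        exists (e1 j), 0; rewrite el linear0 addr0; split=> //; first exact: e1U.1.
        by case: (energy_space_subspace fdet m).
      exists 0, (e2 j); rewrite er linear0 add0r; split=> //; last exact: e2U.1.
      by case: (energy_space_subspace f m).
    - have [x [-> _]] := e1U.2 _ Eu; have [y [-> _]] := e2U.2 _ Ev.
      by exists (row_mx x y); rewrite esum row_mxKl row_mxKr.
    - rewrite esum => /inj[x1 x2]; rewrite -[x]hsubmxK.
      rewrite (basis_free (energy_space_subspace f m) e1U x1).
      by rewrite (basis_free (energy_space_subspace fdet m) e2U x2) row_mx0.
  (* One computation serves both traces: [c = 1] for the plain one and [c = -1] for the one with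
     $(-1)^\alpha$. *)
  have blockE (c : R[i]) i : \sum_j block_mx A1 0 0 (c *: A2) i j *: e j =
      match fintype.split i with inl j => f (D_prod s (e1 j))
      | inr j => c *: fdet (D_prod s (e2 j)) end.
    have := esum (row i (block_mx A1 0 0 (c *: A2))).
    under eq_bigr do rewrite mxE.
    move=> ->; rewrite -(fintype.splitK i).
    case: (fintype.split i) => j; rewrite unsplitK /=.
      rewrite A1E [X in _ + fdet X]big1 ?linear0 ?addr0.
        congr (f _); apply: eq_bigr => k _.
        by rewrite mxE mxE block_mxEul.
      by move=> k _; rewrite mxE mxE block_mxEur mxE scale0r.
    rewrite A2E [X in f X + _]big1 ?linear0 ?add0r.
      rewrite -linearZ_LR scaler_sumr; congr (fdet _); apply: eq_bigr => k _.
      by rewrite mxE mxE block_mxEdr mxE scalerA.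
    by move=> k _; rewrite mxE mxE block_mxEdl mxE scale0r.
  have De i : fock_D_prod s (e i) = match fintype.split i with
      inl j => f (D_prod s (e1 j)) | inr j => fdet (D_prod s (e2 j)) end.
    by rewrite /e; case: (fintype.split i) => j; rewrite equivariant_D_prod.
  split.
    rewrite -[A2]scale1r -(mxtrace_block A1 0 0).
    apply: (trace_on_eq (e := e)) => // [c u v _ _|i]; first exact: fock_D_prod_linear.
    rewrite De blockE; case: (fintype.split i) => // j; by rewrite scale1r.
  rewrite -raddfN -scaleN1r -(mxtrace_block A1 0 0).
  have signE u v : sign_pow (alpha (F := F)) (f u + fdet v) = f u - fdet v.
    exact: sign_pow_parity.
  apply: (trace_on_eq (e := e)) => // [c w w'|i].
    move=> /UE[u [v [_ _ ->]]] /UE[u' [v' [_ _ ->]]].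
    rewrite fock_D_prod_linear !DE !signE.
    set a := D_prod s u; set b := D_prod s v.
    set a' := D_prod s u'; set b' := D_prod s v'.
    have -> : c *: (f a + fdet b) + (f a' + fdet b') =
              f (c *: a + a') + fdet (c *: b + b').
      by rewrite !linearP scalerDr addrACA.
    by rewrite signE !linearP scalerDr addrACA.
  rewrite De blockE; case: (fintype.split i) => j.
    by have := signE (D_prod s (e1 j)) 0; rewrite linear0 addr0 subr0.
  by have := signE 0 (D_prod s (e2 j)); rewrite linear0 !add0r scaleN1r.
by split=> m; have [-> ->] := traces m; field.
Qed.
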